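(* Let $[X,\mathcal B,m,\nu]$ be a reversible random walk space and for each $x$ let $A_x\subset\mathrm{supp}(m_x)$ be measurable (as in the context). For $u,v\in L^2(X,\nu)$, $(u,v)\in\partial_{L^2(X,\nu)}\mathcal F_{A,1,m}(u)$ if and only if there exists an antisymmetric $\mathbf g\in L^\infty(X\times X,\nu\otimes m_x)$ with $\|\mathbf g\|_{L^\infty(X\times X,\nu\otimes m_x)}\le1$ such that $$v(x)=-\int_X\mathbf g(x,y)K_A(x,y)\,dm_x(y)\quad\text{for }\nu\text{-a.e. }x\in X,$$ and $$\mathbf g(x,y)K_A(x,y)\in\mathrm{sign}(u(y)-u(x))\,K_A(x,y)\quad\text{for }(\nu\otimes m_x)\text{-a.e. }(x,y)\in X\times X.$$
   Context: A random walk space $[X,\mathcal B,m,\nu]$: measurable space with countably generated $\sigma$-algebra, probability measures $m_x$ with $x\mapsto m_x(B)$ measurable, $\sigma$-finite invariant $\nu$ ($\nu(A)=\int m_x(A)\,d\nu(x)$); reversible: $dm_x(y)d\nu(x)=dm_y(x)d\nu(y)$. $\nu\otimes m_x$ is the measure $dm_x(y)d\nu(x)$ on $X\times X$. $\nabla u(x,y)=u(y)-u(x)$. The set $\{(x,y):y\in A_x\}$ is assumed measurable and $K_A(x,y)=\frac12(\chi_{A_x}(y)+\chi_{A_y}(x))$. $\mathcal F_{A,1,m}(u)=\frac12\int_{X\times X}|\nabla u|K_A\,d(\nu\otimes m_x)$ on $L^2(X,\nu)$, $+\infty$ if infinite. $\mathrm{sign}(r)=\{1\}$ for $r>0$, $\{-1\}$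 for $r<0$, $[-1,1]$ for $r=0$. $\mathbf g$ antisymmetric means $\mathbf g(x,y)=-\mathbf g(y,x)$. $\partial$ denotes the convex subdifferential. *)

(* Defs.v *)
From HB Require Import structures.
From mathcomp Require Import all_boot all_order all_algebra.
From mathcomp Require Import all_classical all_reals all_analysis.
Import Order.TTheory GRing.Theory Num.Theory.

Set Implicit Arguments.
Unset Strict Implicit.
Unset Printing Implicit Defensive.

Local Open Scope classical_set_scope.
Local Open Scope ring_scope.

Section random_walk_defs.
Context d (T : measurableType d) (R : realType).

Definition countably_generated : Prop :=
  exists G : nat -> set T, (@measurable d T) = <<s range G >>.

Definition nu_otimes_m (nu : {measure set T -> \bar R})
  (m : T -> {measure set T -> \bar R}) (C : set (T * T)) : \bar R :=
  (\int[nu]_x m x (xsection C x))%E.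

Definition rws_invariant (nu : {measure set T -> \bar R})
  (m : T -> {measure set T -> \bar R}) : Prop :=
  forall A, measurable A -> nu A = (\int[nu]_x m x A)%E.

Definition rws_reversible (nu : {measure set T -> \bar R})
  (m : T -> {measure set T -> \bar R}) : Prop :=
  forall C, measurable C ->
    nu_otimes_m nu m C = nu_otimes_m nu m ((fun p => (p.2, p.1)) @^-1` C).

Definition ae_nu_m (nu : {measure set T -> \bar R})
  (m : T -> {measure set T -> \bar R}) (P : T * T -> Prop) : Prop :=
  exists N, [/\ measurable N, nu_otimes_m nu m N = 0%E & ~` [set p | P p] `<=` N].

Definition L2fun (nu : {measure set T -> \bar R}) (u : T -> R) : Prop :=
  measurable_fun setT u /\ (\int[nu]_x ((u x) ^+ 2)%:E < +oo)%E.

(** K_A(x,y) = 1/2 (chi_{A_x}(y) + chi_{A_y}(x)), where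
    A = {(x,y) | y \in A_x} *)
Definition KA (A : set (T * T)) (x y : T) : R :=
  2^-1 * (\1_A (x, y) + \1_A (y, x)).

Definition F_A1m (nu : {measure set T -> \bar R})
  (m : T -> {measure set T -> \bar R}) (A : set (T * T)) (u : T -> R)
  : \bar R :=
  ((2^-1)%:E * \int[nu]_x \int[m x]_y (`|u y - u x| * KA A x y)%:E)%E.

Definition subdiff_L2 (nu : {measure set T -> \bar R})
  (F : (T -> R) -> \bar R) (u v : T -> R) : Prop :=
  forall w, L2fun nu w ->
    (F u + (\int[nu]_x (v x * (w x - u x))%:E) <= F w)%E.



End random_walk_defs.
Arguments KA {d T R} A x y.

Definition sign_set (R : realType) (r : R) : set R :=
  if 0 < r then [set 1] else if r < 0 then [set -1]
  else [set s | -1 <= s <= 1].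

(* Main.v *)
Require Import Defs.
From HB Require Import structures.
From mathcomp Require Import all_boot all_order all_algebra.
From mathcomp Require Import all_classical all_reals all_analysis.
From mathcomp Require Import finmap measurable_realfun ring lra.
Import Order.TTheory GRing.Theory Num.Theory.
Import numFieldNormedType.Exports.
Local Open Scope classical_set_scope.
Local Open Scope ring_scope.

(** The energy [F w] is half the norm of [K * grad w] in [L^1(nu (x) m)], so
    [(u, v)] lies in its subdifferential iff [F u <= <v, u>] and
    [<v, w> <= F w] for all [w] in [L^2(nu)].

    Given these inequalities, [K * grad w |-> 2 <v, w>] is bounded by the
    [L^1] norm; Hahn-Banach extends it to [L^1(nu (x) m)] and the duality
    between [L^1] and [L^oo] represents it by some [g] with [|g| <= 1], which
    reversibility allows to antisymmetrize.  Indicators [w] of sets of finite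
    measure yield [v = - int g K dm_x], and equality in [F u = <v, u>] yields
    the sign condition.

    Since [nu] may be infinite, [w] in [L^2] need not be integrable, and the
    integration by parts [<v, w> = 1/2 int (grad w) g K] is only available for
    integrable [w].  It is applied to soft thresholds of [w], which are
    integrable, and whose gradient is dominated by that of [w] and has the same
    sign; the threshold then tends to [0]. *)

(** * Hahn-Banach *)

Section hahn_banach.
Context {R : realType} {V : lmodType R}.
Implicit Types (p q s : V -> R) (G : set (V * R)).

Definition sublinear p :=
  (forall x y, p (x + y) <= p x + p y) /\
  (forall (t : R) x, 0 < t -> p (t *: x) = t * p x).

Lemma sublinear0 p : sublinear p -> p 0 = 0.
Proof.
move=> [_ /(_ 2 0 (ltr0n _ 2))]; rewrite scaler0 => h; lra.
Qed.

Lemma sublinear_geN p x : sublinear p -> - p (- x) <= p x.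
Proof.
move=> sp; have := sp.1 x (- x); rewrite subrr sublinear0//; lra.
Qed.

(** A pair [(y, c)] of [G] asks for the value [c] at [y]: since [inf_cone p G (- y) <= p 0 - c], any
    linear functional below [inf_cone p G] is at least [c] at [y]. *)
Definition inf_cone p G x := inf [set p (x + z.1) - z.2 | z in G].

Section inf_cone.
Variables (p : V -> R) (G : set (V * R)).
Hypotheses (sp : sublinear p) (G0 : G (0, 0))
  (GD : forall y z, G y -> G z -> G (y.1 + z.1, y.2 + z.2))
  (GZ : forall (t : R) z, 0 < t -> G z -> G (t *: z.1, t * z.2))
  (Gp : forall z, G z -> z.2 <= p z.1).

(** This lower bound, due to [Gp], makes the real infimum meaningful. *)
Let inf_cone_lb x r : [set p (x + z.1) - z.2 | z in G] r -> - p (- x) <= r.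
Proof.
move=> [z Gz <-].
have := sp.1 (x + z.1) (- x); rewrite addrAC subrr add0r => h.
have := Gp _ Gz; lra.
Qed.

Lemma inf_cone_le x z : G z -> inf_cone p G x <= p (x + z.1) - z.2.
Proof.
by move=> Gz; apply: ge_inf; [exists (- p (- x)); exact: inf_cone_lb|exists z].
Qed.

Let le_inf_cone x a : (forall z, G z -> a <= p (x + z.1) - z.2) ->
  a <= inf_cone p G x.
Proof.
move=> h; apply: lb_le_inf; first by exists (p (x + 0) - 0), (0, 0).
by move=> _ [z Gz <-]; exact: h.
Qed.

(** Adding two pairs of [G] gives subadditivity; rescaling a pair by [t] and by [t^-1] gives the two
    inequalities of homogeneity. *)
Lemma inf_cone_sublinear : sublinear (inf_cone p G).
Proof.
split=> [x y|t x t0].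
- rewrite -lerBlDr; apply: le_inf_cone => z Gz.
  rewrite lerBlDr -lerBlDl; apply: le_inf_cone => w Gw.
  have := inf_cone_le (x + y) _ (GD _ _ Gz Gw).
  rewrite /= addrACA; have := sp.1 (x + z.1) (y + w.1); lra.
- apply/eqP; rewrite eq_le; apply/andP; split.
    rewrite mulrC -ler_pdivrMr//; apply: le_inf_cone => z Gz.
    rewrite ler_pdivrMr//; have := inf_cone_le (t *: x) _ (GZ _ _ t0 Gz).
    rewrite /= -scalerDr sp.2//; lra.
  apply: le_inf_cone => z Gz.
  have ti0 : 0 < t^-1 by rewrite invr_gt0.
  have := inf_cone_le x _ (GZ _ _ ti0 Gz) => /=.
  have -> : x + t^-1 *: z.1 = t^-1 *: (t *: x + z.1).
    by rewrite scalerDr scalerA mulVf ?scale1r// gt_eqF.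
  by rewrite sp.2// -mulrBr mulrC ler_pdivlMr// mulrC.
Qed.

End inf_cone.

(** Zorn's lemma for the reversed pointwise order: a chain is bounded by its pointwise infimum,
    which is finite because every member [q] satisfies [- p (- x) <= - q (- x) <= q x]. *)
Lemma sublinear_minimal p : sublinear p ->
  exists s, [/\ sublinear s, forall x, s x <= p x &
    forall q, sublinear q -> (forall x, q x <= s x) -> forall x, s x <= q x].
Proof.
move=> sp; pose U := {q : V -> R | sublinear q /\ forall x, q x <= p x}.
pose ge (a b : U) := `[< forall x, sval b x <= sval a x >].
pose p0 : U := exist _ p (conj sp (fun x => lexx (p x))).
have [||A Atot|[s [ss sp']] smin] := ZL_preorder p0 (R := ge).
- by move=> a; apply/asboolP => x.
- by move=> a b c /asboolP ba /asboolP ac; apply/asboolP => x;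
    exact: le_trans (ac x) (ba x).
- have [->|/set0P[a0 Aa0]] := eqVneq A set0; first by exists p0.
  pose E x := [set sval a x | a in A].
  have Elb x r : E x r -> - p (- x) <= r.
    move=> [a _ <-]; apply: le_trans (sublinear_geN _ x (svalP a).1).
    by rewrite lerN2; exact: (svalP a).2.
  have E0 x : E x !=set0 by exists (sval a0 x), a0.
  pose q x := inf (E x).
  have qle a x : A a -> q x <= sval a x.
    by move=> Aa; apply: ge_inf; [exists (- p (- x)); exact: Elb|exists a].
  have sq : sublinear q.
    split=> [x y|t x t0].
    + rewrite -lerBlDr; apply: lb_le_inf => // _ [a Aa <-].
      rewrite lerBlDr -lerBlDl; apply: lb_le_inf => // _ [b Ab <-].
      (* The chain condition enters here: the smaller of [a] and [b] is tested at [x + y], and is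
         below the other one at the remaining point. *)
      have [/asboolP ab|/asboolP ba] := Atot _ _ Aa Ab.
      * have := qle _ (x + y) Ab; have := (svalP b).1.1 x y.
        have := ab x; lra.
      * have := qle _ (x + y) Aa; have := (svalP a).1.1 x y.
        have := ba y; lra.
    + apply/eqP; rewrite eq_le; apply/andP; split.
        rewrite mulrC -ler_pdivrMr//; apply: lb_le_inf => // _ [a Aa <-].
        rewrite ler_pdivrMr// mulrC -(svalP a).1.2//; exact: qle.
      apply: lb_le_inf => // _ [a Aa <-].
      by rewrite (svalP a).1.2// ler_pM2l//; exact: qle.
  have qp x : q x <= p x by exact: le_trans (qle _ x Aa0) ((svalP a0).2 x).
  exists (exist _ q (conj sq qp)) => a Aa; apply/asboolP => x /=; exact: qle.
- exists s; split => // q sq qs.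
  have qp x : q x <= p x by exact: le_trans (qs x) (sp' x).
  by have /asboolP := smin (exist _ q (conj sq qp)) (introT (asboolP _) qs).
Qed.

(* [inf_cone s] over the ray through [y] lies below [s], and is at most [- s y]
   at [- y]. *)
Lemma minimal_sublinear_opp s : sublinear s ->
  (forall q, sublinear q -> (forall x, q x <= s x) -> forall x, s x <= q x) ->
  forall x, s (- x) = - s x.
Proof.
move=> ss smin y.
pose G := [set (t *: y, t * s y) | t in [set t : R | 0 <= t]].
have G0 : G (0, 0) by exists 0 => /=; rewrite ?scale0r ?mul0r.
have GD a b : G a -> G b -> G (a.1 + b.1, a.2 + b.2).
  move=> [t t0 <-] [r r0 <-]; exists (t + r); first exact: addr_ge0.
  by rewrite scalerDl mulrDl.
have GZ (t : R) a : 0 < t -> G a -> G (t *: a.1, t * a.2).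
  move=> t0 [r r0 <-]; exists (t * r); first by rewrite /= mulr_ge0// ltW.
  by rewrite /= scalerA mulrA.
have Gs a : G a -> a.2 <= s a.1.
  move=> [t /=]; rewrite le_eqVlt => /predU1P[<- <-/=|t0 <-/=].
    by rewrite scale0r mul0r sublinear0.
  by rewrite ss.2.
have h := smin _ (inf_cone_sublinear _ _ ss G0 GD GZ Gs).
have : s (- y) <= inf_cone s G (- y).
  by apply: h => x; have := inf_cone_le s G ss Gs x _ G0; rewrite addr0 subr0.
have := inf_cone_le s G ss Gs (- y) (y, s y).
rewrite /= addNr sublinear0// => /(_ _) h1.
have : inf_cone s G (- y) <= 0 - s y.
  by apply: h1; exists 1; rewrite //= scale1r mul1r.
have := sublinear_geN s (- y) ss; rewrite opprK; lra.
Qed.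

(** A minimal sublinear function is odd, and oddness turns subadditivity at [x + y] and [- y] into
    the reverse inequality, hence into linearity. *)
Theorem hahn_banach p : sublinear p ->
  exists l : V -> R, [/\ forall x y, l (x + y) = l x + l y,
    forall (t : R) x, l (t *: x) = t * l x & forall x, l x <= p x].
Proof.
move=> /sublinear_minimal[s [ss sp smin]].
have sN := minimal_sublinear_opp s ss smin.
exists s; split => // [x y|t x].
  have := ss.1 x y; have := ss.1 (x + y) (- y); rewrite addrK sN.
  by move=> h1 h2; apply/eqP; rewrite eq_le h2; lra.
have [t0|t0|->] := ltgtP t 0; last by rewrite scale0r mul0r sublinear0.
  by rewrite -[t in LHS]opprK scaleNr sN ss.2 ?oppr_gt0// mulNr opprK.
exact: ss.2.
Qed.

(* The functional prescribed on the cone [G] is absorbed into a smaller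
   sublinear bound, so no partially defined functional has to be extended. *)
Corollary hahn_banach_extension p G : sublinear p -> G (0, 0) ->
  (forall y z, G y -> G z -> G (y.1 + z.1, y.2 + z.2)) ->
  (forall (t : R) z, G z -> G (t *: z.1, t * z.2)) ->
  (forall z, G z -> z.2 <= p z.1) ->
  exists l : V -> R, [/\ forall x y, l (x + y) = l x + l y,
    forall (t : R) x, l (t *: x) = t * l x, forall x, l x <= p x &
    forall z, G z -> l z.1 = z.2].
Proof.
move=> sp G0 GD GZ Gp.
have [l [lD lZ lq]] := hahn_banach _
  (inf_cone_sublinear _ _ sp G0 GD (fun t z _ => GZ t z) Gp).
have lG z : G z -> z.2 <= l z.1.
  move=> Gz; have := le_trans (lq _) (inf_cone_le _ _ sp Gp (- z.1) _ Gz).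
  by rewrite addNr sublinear0// -scaleN1r lZ; lra.
exists l; split => // [x|z Gz].
  by have := inf_cone_le _ _ sp Gp x _ G0; rewrite addr0 subr0; exact: le_trans.
(* [G] is stable under all real scalars, so the inequality [lG] also holds for the opposite pair. *)
apply/eqP; rewrite eq_le lG// andbT.
have := lG _ (GZ (-1) _ Gz); rewrite /= lZ; lra.
Qed.

End hahn_banach.

(** * The dual of [L^1] *)

Lemma integral_indicM {d : measure_display} {T : measurableType d} {R : realType}
    (nu : {measure set T -> \bar R}) (B : set T) (f : T -> \bar R) :
  (\int[nu]_x ((\1_B x)%:E * f x) = \int[nu]_(x in B) f x)%E.
Proof.
rewrite [RHS]integral_mkcond; apply: eq_integral => x _.
by rewrite patchE indicE; case: (x \in B); rewrite ?mul1e ?mul0e.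
Qed.

Section L1_dual.
Context {d : measure_display} {X : measurableType d} {R : realType}.
Implicit Types (f g : X -> R) (D : (X -> R) -> R).

(** [D] acts on functions rather than on classes; the bound forces equal values on integrable
    functions that agree almost everywhere. It is stated on one side only, linearity giving the
    other. *)
Definition L1_functional (mu : {measure set X -> \bar R}) (c : R) D :=
  [/\ forall f g, mu.-integrable setT (EFin \o f) ->
        mu.-integrable setT (EFin \o g) ->
        D (fun x => f x + g x) = D f + D g,
      forall (a : R) f, mu.-integrable setT (EFin \o f) ->
        D (fun x => a * f x) = a * D f &
      forall f, mu.-integrable setT (EFin \o f) ->
        ((D f)%:E <= c%:E * \int[mu]_x (`|f x|)%:E)%E].

Lemma measurable_inv_gt0 f : (forall x, 0 < f x) -> measurable_fun setT f ->
  measurable_fun setT (fun x => (f x)^-1).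
Proof.
move=> f0 mf; rewrite (_ : (fun x => _) = (fun x => f x `^ (-1))).
  exact: measurableT_comp (measurable_powR _) mf.
by apply/funext => x; rewrite powR_inv1// ltW.
Qed.

Section functional.
Variables (mu : {measure set X -> \bar R}) (c : R) (D : (X -> R) -> R).
Hypothesis LD : L1_functional mu c D.
Local Notation intg f := (mu.-integrable setT (EFin \o f)).

Lemma integrable_addR f g : intg f -> intg g -> intg (fun x => f x + g x).
Proof.
by move=> fi gi; apply: eq_integrable (integrableD measurableT fi gi).
Qed.

Lemma integrable_mulR (a : R) f : intg f -> intg (fun x => a * f x).
Proof.
by move=> fi; apply: eq_integrable (integrableZl measurableT a fi).
Qed.

Lemma L1_functional0 : D (fun=> 0) = 0.
Proof.
have [_ DZ _] := LD.
have := DZ 0 (fun=> 0) (integrable0 _ _).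
by rewrite !mul0r.
Qed.

Lemma L1_functional_sub f g : intg f -> intg g ->
  D (fun x => f x - g x) = D f - D g.
Proof.
have [DD DZ _] := LD => fi gi.
rewrite -[- D g]mulN1r -DZ// -DD//; last exact: integrable_mulR.
by congr D; apply/funext => x; rewrite mulN1r.
Qed.

Lemma L1_functional_abs f : intg f ->
  ((`|D f|)%:E <= c%:E * \int[mu]_x (`|f x|)%:E)%E.
Proof.
have [_ DZ Dle] := LD => fi.
have [D0|D0] := leP 0 (D f); first by rewrite ger0_norm//; exact: Dle.
rewrite ltr0_norm// -mulN1r -DZ//.
apply: le_trans (Dle _ (integrable_mulR _ _ fi)) _.
by under eq_integral do rewrite mulN1r normrN.
Qed.

Lemma L1_functional_sum (I : Type) (s : seq I) (F : I -> X -> R) :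
  (forall i, intg (F i)) ->
  D (fun x => \sum_(i <- s) F i x) = \sum_(i <- s) D (F i).
Proof.
have [DD _ _] := LD => Fi.
have Fs (t : seq I) : intg (fun x => \sum_(i <- t) F i x).
  apply: eq_integrable
    (integrable_sum measurableT t (P := predT) (fun i _ => Fi i)) => //.
  by move=> x _; rewrite /= sumEFin.
elim: s => [|i s ih].
  rewrite big_nil -[RHS]L1_functional0.
  by congr D; apply/funext => x; rewrite big_nil.
rewrite big_cons -ih -DD//.
by congr D; apply/funext => x; rewrite big_cons.
Qed.

(** Dominated convergence gives [f_ n --> f] in the [L^1] norm, which controls [|D (f_ n) - D f|] up
    to the factor [c]. *)
Lemma L1_functional_dominated (f_ : nat -> X -> R) (f G : X -> R) :
  (forall n, measurable_fun setT (f_ n)) -> measurable_fun setT f ->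
  (forall x, f_ ^~ x @ \oo --> f x) -> intg G ->
  (forall n x, `|f_ n x| <= G x) -> D (f_ n) @[n --> \oo] --> D f.
Proof.
move=> mf_ mf f_f Gi fG.
have f_i n : intg (f_ n).
  apply: le_integrable Gi => //; first exact/measurable_EFinP.
  by move=> x _ /=; rewrite lee_fin (le_trans (fG n x))// ler_norm.
have [fi h _] : [/\ intg f,
    (\int[mu]_x `|(f_ n x)%:E - (f x)%:E|)%E @[n --> \oo] --> 0%E & True].
  have [] := @dominated_convergence _ _ _ mu setT measurableT
    (fun n => EFin \o f_ n) (EFin \o f) (EFin \o G) => //.
  - by move=> n; exact/measurable_EFinP.
  - exact/measurable_EFinP.
  - by apply: aeW => x _; apply: cvg_EFin; [exact: nearW|exact: f_f].
  - by apply: aeW => x n _ /=; rewrite lee_fin.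
have Dn : (`|D (f_ n) - D f|)%:E @[n --> \oo] --> 0%E.
  apply: (@squeeze_cvge _ _ _ _ (cst 0%E) _
    (fun n => c%:E * \int[mu]_x `|(f_ n x)%:E - (f x)%:E|)%E).
  - apply: nearW => n; rewrite lee_fin normr_ge0/=.
    rewrite -L1_functional_sub//; apply: L1_functional_abs.
    exact: eq_integrable (integrableB measurableT (f_i n) fi).
  - exact: cvg_cst.
  - by rewrite -(mule0 c%:E); exact: cvgeZl.
by apply/subr_cvg0/norm_cvg0P; exact: fine_cvg Dn.
Qed.

Section weighted_indicators.
Import HBNNSimple.
Variable h : X -> R.
Hypotheses (h_gt0 : forall x, 0 < h x) (h_int : intg h).

Lemma measurable_weight : measurable_fun setT h.
Proof. by apply/measurable_EFinP; exact: measurable_int h_int. Qed.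

Lemma measurable_weighted_indic C : measurable C ->
  measurable_fun setT (fun x => h x * \1_C x).
Proof.
move=> mC; apply: measurable_funM measurable_weight _.
exact: measurable_indic.
Qed.

Lemma weighted_indic_le C x : `|h x * \1_C x| <= h x.
Proof.
have h0 := ltW (h_gt0 x); rewrite normrM ger0_norm// ler_piMr//.
by rewrite indicE; case: (x \in C); rewrite /= ?normr1 ?normr0.
Qed.

Lemma integrable_weighted_indic C : measurable C ->
  intg (fun x => h x * \1_C x).
Proof.
move=> mC; apply: le_integrable h_int => //.
  exact/measurable_EFinP/measurable_weighted_indic.
move=> x _ /=; rewrite lee_fin (le_trans (weighted_indic_le _ _))//.
exact: ler_norm.
Qed.

(** The weight makes [h * \1_C] integrable even when [C] has infinite measure. For [f >= 0], simple
    functions [s n] increasing to [f / h] yield combinations [h * s n] of weighted indicators that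
    tend to [f] and are dominated by it; a general [f] is split into its positive and negative
    parts. *)
Lemma L1_functional_eq0 :
  (forall C, measurable C -> D (fun x => h x * \1_C x) = 0) ->
  forall f, intg f -> D f = 0.
Proof.
have [_ DZ _] := LD => D0.
have step f : intg f -> (forall x, 0 <= f x) -> D f = 0.
  move=> fi f0; have mf : measurable_fun setT f.
    by apply/measurable_EFinP; exact: measurable_int fi.
  have mfh : measurable_fun setT (fun x => (f x / h x)%:E).
    apply/measurable_EFinP/measurable_funM => //.
    exact: measurable_inv_gt0 measurable_weight.
  pose s := nnsfun_approx measurableT mfh.
  have fh0 x : setT x -> (0 <= (f x / h x)%:E)%E.
    by rewrite lee_fin divr_ge0// ltW.
  have s_cvg x : s n x @[n --> \oo] --> f x / h x.
    have /fine_cvg : (s n x)%:E @[n --> \oo] --> (f x / h x)%:E.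
      exact: cvg_nnsfun_approx.
    exact.
  have s_le n x : s n x <= f x / h x.
    rewrite -(cvg_lim _ (s_cvg x))//.
    apply: nondecreasing_cvgn_le; last by apply/cvg_ex; eexists; exact: s_cvg.
    by move=> a b ab; exact/lefP/nd_nnsfun_approx.
  have Ds n : D (fun x => h x * s n x) = 0.
    have -> : (fun x => h x * s n x) = (fun x =>
        \sum_(y <- fset_set (range (s n)))
          y * (h x * \1_(s n @^-1` [set y]) x)).
      apply/funext => x; rewrite [in LHS]fimfunE fsbig_finite//= mulr_sumr.
      by apply: eq_bigr => y _; rewrite mulrCA.
    rewrite L1_functional_sum; last first.
      by move=> i; apply/integrable_mulR/integrable_weighted_indic.
    rewrite big1// => i _; rewrite DZ ?D0 ?mulr0//.
    exact: integrable_weighted_indic.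
  have := @L1_functional_dominated (fun n x => h x * s n x) f f.
  move=> /(_ _ mf _ fi _)/cvg_lim; rewrite /comp; under eq_fun do rewrite Ds.
  rewrite lim_cst// => <- //.
  - move=> n; apply: measurable_funM => //; exact: measurable_weight.
  - move=> x; have -> : f x = h x * (f x / h x) by rewrite mulrC divfK// gt_eqF.
    exact: cvgMr (s_cvg x).
  - move=> n x; have h0 := ltW (h_gt0 x); rewrite ger0_norm ?mulr_ge0//.
    by rewrite mulrC -ler_pdivlMr.
move=> f fi.
have fip := integrable_funrpos measurableT fi.
have fin := integrable_funrneg measurableT fi.
rewrite -[f]funrposBneg (L1_functional_sub _ _ fip fin) !step ?subrr//.
Qed.

End weighted_indicators.

End functional.

(** On [C = {g < f}] the difference [f - g] is positive while its integral is at most [0], so [C] is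
    negligible. *)
Lemma ae_le_of_integral_le (mu : {measure set X -> \bar R}) f g :
  mu.-integrable setT (EFin \o f) -> mu.-integrable setT (EFin \o g) ->
  (forall C, measurable C ->
    (\int[mu]_(x in C) (f x)%:E <= \int[mu]_(x in C) (g x)%:E)%E) ->
  {ae mu, forall x, f x <= g x}.
Proof.
move=> fi gi fg.
have /measurable_EFinP mf := measurable_int _ fi.
have /measurable_EFinP mg := measurable_int _ gi.
pose C := [set x | g x < f x].
have mC : measurable C.
  rewrite -[C]setTI (_ : C = (fun x => g x < f x) @^-1` [set true])//.
  exact: measurable_fun_ltr mg mf _ _ _.
have fiC := integrableS measurableT mC (@subsetT _ _) fi.
have giC := integrableS measurableT mC (@subsetT _ _) gi.
have fgC : (\int[mu]_(x in C) `|(f x)%:E - (g x)%:E| = 0)%E.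
  rewrite (eq_integral (fun x => (f x)%:E - (g x)%:E)%E); last first.
    by move=> x /set_mem Cx; rewrite gee0_abs// -EFinB lee_fin subr_ge0 ltW.
  apply/eqP; rewrite eq_le; apply/andP; split; last first.
    by apply: integral_ge0 => x Cx; rewrite -EFinB lee_fin subr_ge0 ltW.
  rewrite (integralB_EFin mC fiC giC) sube_le0; exact: fg.
have /(ae_eq_integral_abs _ mC) :
    measurable_fun C (fun x => (f x)%:E - (g x)%:E)%E.
  apply: measurable_funTS; apply: emeasurable_funB; exact/measurable_EFinP.
move=> /(_ mu)/iffLR/(_ fgC); apply: filterS => x h.
rewrite leNgt; apply/negP => Cx; have := h Cx.
by move=> /eqP; rewrite -EFinB eqe subr_eq0 gt_eqF.
Qed.

(* Testing the functional on [h * \1_C], with [h] positive and integrable,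
   yields a finite charge, which is what Radon-Nikodym requires. *)
Theorem L1_dual (mu : {sigma_finite_measure set X -> \bar R}) (h : X -> R) D :
  (forall x, 0 < h x) -> mu.-integrable setT (EFin \o h) ->
  L1_functional mu 1 D ->
  exists g : X -> R, [/\ measurable_fun setT g, forall x, `|g x| <= 1 &
    forall f, mu.-integrable setT (EFin \o f) ->
      (D f)%:E = (\int[mu]_x (f x * g x)%:E)%E].
Proof.
move=> h_gt0 h_int LD; have [DD DZ Dle] := LD.
have mh := measurable_weight _ _ h_int.
have ihC := integrable_weighted_indic _ _ h_gt0 h_int.
have indicT (f : X -> R) C : measurable C ->
    (\int[mu]_x (f x * \1_C x)%:E = \int[mu]_(x in C) (f x)%:E)%E.
  move=> mC; rewrite -[RHS]integral_indicM; apply: eq_integral => x _.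
  by rewrite mulrC.
pose lam C : \bar R := (D (fun x => h x * \1_C x))%:E.
have lam_le C : measurable C -> (`|lam C| <= \int[mu]_(x in C) (h x)%:E)%E.
  move=> mC; have := L1_functional_abs _ _ _ LD _ (ihC _ mC).
  rewrite mul1e => /le_trans; apply; rewrite -indicT//.
  rewrite le_eqVlt; apply/orP; left; apply/eqP; apply: eq_integral => x _.
  by rewrite ger0_norm// mulr_ge0// ltW.
have lam0 : lam set0 = 0%E.
  rewrite /lam (_ : (fun _ => _) = (fun=> 0)) ?(L1_functional0 _ _ _ LD)//.
  by apply/funext => x; rewrite indic0 mulr0.
have lam_fin C : measurable C -> lam C \is a fin_num by [].
have lam_sigma : semi_sigma_additive lam.
  move=> F mF tF mUF.
  pose f_ n x := \sum_(0 <= i < n) h x * \1_(F i) x.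
  have f_E n : (\sum_(0 <= i < n) lam (F i))%E = (D (f_ n))%:E.
    by rewrite /lam sumEFin (L1_functional_sum _ _ _ LD)// => i; exact: ihC.
  under eq_fun do rewrite f_E.
  apply: cvg_EFin; first exact: nearW.
  (* By disjointness only the [k]-th term survives on [F k], and the partial sum over [i < n]
     contains it exactly when [k < n]. All partial sums are therefore dominated by [h]. *)
  have f_in k n x : F k x -> f_ n x = h x * (k < n)%:R.
    move=> Fkx; rewrite /f_ -mulr_sumr; congr (_ * _).
    rewrite (eq_bigr (fun i => if i == k then 1 else 0)) => [|i _].
      by rewrite -big_mkcond big_nat1_eq/=; case: ltnP.
    rewrite indicE; case: eqVneq => [->|ik]; first by rewrite mem_set.
    rewrite memNset// => Fix; move/eqP: ik; apply.
    by apply: tF => //; exists x.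
  have f_out n x : ~ (\bigcup_i F i) x -> f_ n x = 0.
    move=> Fx; rewrite /f_ big1// => i _; rewrite indicE memNset ?mulr0//.
    by move=> Fix; apply: Fx; exists i.
  apply: (L1_functional_dominated _ _ _ LD _ _ h) => //.
  - move=> n; apply: measurable_sum => i.
    exact: measurable_weighted_indic h_int _ _.
  - exact: measurable_weighted_indic h_int _ _.
  - move=> x; have [[k _ Fkx]|Fx] := pselect ((\bigcup_i F i) x).
      rewrite indicE mem_set; last by exists k.
      apply: cvg_near_cst; near=> n; rewrite (f_in k)//.
      have -> // : (k < n)%N by near: n; exists k.+1.
    rewrite indicE memNset// mulr0; under eq_fun do rewrite f_out//.
    exact: cvg_cst.
  - move=> n x; have h0 := ltW (h_gt0 x).
    have [[k _ Fkx]|Fx] := pselect ((\bigcup_i F i) x).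
      rewrite (f_in k _ _ Fkx) ger0_norm ?mulr_ge0//.
      by case: (k < n)%N; rewrite /= ?mulr1 ?mulr0.
    by rewrite f_out// normr0.
pose lamC := isCharge.Build d X R lam lam0 lam_fin lam_sigma.
pose nu : {charge set X -> \bar R} := HB.pack lam lamC.
have numu : nu `<< mu.
  apply/null_content_dominatesP => C mC C0; apply/eqP.
  rewrite -abse_eq0 eq_le abse_ge0 andbT (le_trans (lam_le _ mC))//.
  by rewrite null_set_integral//; exact/measurable_funTS/measurable_EFinP.
have [k [kfin ki kE]] : exists k : X -> \bar R, [/\ forall x, k x \is a fin_num,
    mu.-integrable setT k &
    forall C, measurable C -> lam C = \int[mu]_(x in C) k x]%E.
  exists (Radon_Nikodym nu mu); split.
  - by move=> x; exact: Radon_Nikodym_fin_num.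
  - exact: Radon_Nikodym_integrable.
  - by move=> C mC; exact: (Radon_Nikodym_integral (nu := nu)).
pose kr x := fine (k x).
have krE : k = EFin \o kr by apply/funext => x; rewrite /= fineK.
rewrite krE in ki kE.
have /measurable_EFinP mkr := measurable_int _ ki.
(* The bound of [lam C] by the integral of [h] over [C] passes to the density. *)
have kh : {ae mu, forall x, `|kr x| <= h x}.
  have kle : {ae mu, forall x, kr x <= h x}.
    apply: ae_le_of_integral_le => // C mC.
    by rewrite -kE//; apply: le_trans (lam_le _ mC); exact: lee_abs.
  have kge : {ae mu, forall x, - kr x <= h x}.
    apply: ae_le_of_integral_le => // [|C mC].
      exact: eq_integrable (integrableN ki).
    apply: le_trans (lam_le _ mC); rewrite kE//.
    under eq_integral do rewrite EFinN.
    rewrite integralN; last first.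
      exact/integrable_add_def/(integrableS measurableT mC (@subsetT _ _) ki).
    by rewrite -abseN lee_abs.
  by apply: filterS2 kle kge => x a b; rewrite ler_norml a lerNl b.
(* Clipping [kr / h] to [[-1, 1]] makes the bound hold everywhere and, by [kh], changes it only on a
   null set. *)
pose g x := Num.max (-1) (Num.min 1 (kr x / h x)).
have g1 x : `|g x| <= 1.
  rewrite ler_norml le_max lexx/= ge_max ge_min lexx/= andbT; lra.
have mg : measurable_fun setT g.
  apply: measurable_maxr => //; apply: measurable_minr => //.
  by apply: measurable_funM => //; exact: measurable_inv_gt0.
have hg : {ae mu, forall x, h x * g x = kr x}.
  apply: filterS kh => x khx; rewrite /g.
  have : `|kr x / h x| <= 1.
    by rewrite normrM normfV (gtr0_norm (h_gt0 x)) ler_pdivrMr// mul1r.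
  rewrite ler_norml => /andP[k1 k2].
  by rewrite (min_idPr k2) (max_idPr k1) mulrC divfK// gt_eqF.
have fgi f : mu.-integrable setT (EFin \o f) ->
    mu.-integrable setT (fun x => (f x * g x)%:E).
  move=> fi; have /measurable_EFinP mf := measurable_int _ fi.
  apply: le_integrable fi => //; first exact/measurable_EFinP/measurable_funM.
  by move=> x _ /=; rewrite lee_fin normrM ler_piMr.
exists g; split => // f fi.
(* [E] is again a bounded functional, with constant [2]: one from [D] and one from the integral
   against [g]. It remains to see that it vanishes on weighted indicators. *)
pose E f := D f - fine (\int[mu]_x (f x * g x)%:E).
suff : E f = 0.
  move=> /eqP; rewrite subr_eq0 => /eqP ->.
  by rewrite fineK// integrable_fin_num//; exact: fgi.
apply: (L1_functional_eq0 mu 2 E _ h) => // [|C mC].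
  split.
  - move=> f1 f2 f1i f2i; rewrite /E DD//.
    rewrite (_ : (fun x => ((f1 x + f2 x) * g x)%:E) =
        (fun x => (f1 x * g x)%:E + (f2 x * g x)%:E)%E); last first.
      by apply/funext => x; rewrite mulrDl.
    rewrite integralD//; [|exact: fgi..].
    rewrite fineD; [|exact/integrable_fin_num/fgi..].
    lra.
  - move=> a f1 f1i; rewrite /E DZ//.
    rewrite (_ : (fun x => (a * f1 x * g x)%:E) =
        (fun x => a%:E * (f1 x * g x)%:E)%E); last first.
      by apply/funext => x; rewrite -mulrA.
    rewrite integralZl//; last exact: fgi.
    rewrite fineM//; last exact/integrable_fin_num/fgi.
    rewrite /=; lra.
  - move=> f1 f1i; rewrite /E EFinB fineK; last exact/integrable_fin_num/fgi.
    rewrite (_ : 2%:E = 1 + 1)%E// ge0_muleDl// mul1e leeD//.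
      by have := Dle _ f1i; rewrite mul1e.
    rewrite (le_trans (lee_abs _))// abseN.
    have /integrableP[mfg _] := fgi _ f1i.
    apply: (le_trans (le_abse_integral _ measurableT mfg)).
    apply: ge0_le_integral => //.
    + exact: measurableT_comp.
    + by have /integrable_norm/measurable_int := f1i.
    + by move=> x _; rewrite lee_fin normrM ler_piMr.
apply/eqP; rewrite subr_eq0; apply/eqP/EFin_inj.
rewrite fineK; last exact/integrable_fin_num/fgi/ihC.
rewrite -/(lam C) kE//.
under [RHS]eq_integral do rewrite mulrAC.
rewrite indicT//; apply: ae_eq_integral => //.
- exact/measurable_funTS/measurable_EFinP.
- exact/measurable_funTS/measurable_EFinP/measurable_funM.
- by apply: filterS hg => x hgx _; rewrite /= hgx.
Unshelve. all: by end_near. Qed.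

End L1_dual.

(** [W] is the graph of a linear functional on a subspace of the integrable functions. Hahn-Banach
    is applied in [LfunType mu], a space of functions, where the [L^1] norm is the sublinear
    bound. *)
Lemma L1_functional_extension {d : measure_display} {X : measurableType d}
    {R : realType} (mu : {measure set X -> \bar R}) (W : set ((X -> R) * R)) :
  W (fun=> 0, 0) ->
  (forall y z, W y -> W z -> W (fun x => y.1 x + z.1 x, y.2 + z.2)) ->
  (forall (a : R) z, W z -> W (fun x => a * z.1 x, a * z.2)) ->
  (forall z, W z -> mu.-integrable setT (EFin \o z.1)) ->
  (forall z, W z -> (z.2%:E <= \int[mu]_x (`|z.1 x|)%:E)%E) ->
  exists D, L1_functional mu 1 D /\ forall z, W z -> D z.1 = z.2.
Proof.
move=> W0 WD WZ Wi Wle.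
pose V : lmodType R := LfunType mu (lexx 1%E).
pose p (f : V) := fine ('N[mu]_1[EFin \o (f : LfunType mu (lexx 1%E))])%E.
have pE (f : V) :
    (p f)%:E = (\int[mu]_x (`|(f : LfunType mu (lexx 1%E)) x|)%:E)%E.
  by rewrite finite_norm_fine Lnorm1.
have sp : sublinear p.
  split=> [f g|t f t0]; first exact: ler_LnormD.
  apply: EFin_inj; rewrite EFinM /p !finite_norm_fine.
  by rewrite LnormZ gtr0_norm.
pose G : set (V * R) :=
  [set z | W ((z.1 : LfunType mu (lexx 1%E)) : X -> R, z.2)].
have [l [lD lZ lp lG]] : exists l : V -> R, [/\ forall x y, l (x + y) = l x + l y,
    forall (t : R) x, l (t *: x) = t * l x, forall x, l x <= p x &
    forall z, G z -> l z.1 = z.2].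
  apply: hahn_banach_extension => //.
  - by move=> y z Gy Gz; exact: WD _ _ Gy Gz.
  - by move=> t z Gz; exact: WZ t _ Gz.
  - move=> z Gz; rewrite -lee_fin pE; exact: Wle _ Gz.
(* The value [0] off the integrable functions is arbitrary: [L1_functional] constrains [D] on
   integrable functions only. *)
pose D (f : X -> R) : R := if pselect (f \in Lfun mu 1) is left fL
  then l (Lfun_Sub (lexx 1%E) fL) else 0.
have DE (f : V) : D (f : LfunType mu (lexx 1%E)) = l f.
  rewrite /D; case: pselect => [fL|]; last by move/(_ (LfunP f)).
  by congr l; exact/LfuneqP.
have toV f : mu.-integrable setT (EFin \o f) ->
    exists F : V, (F : LfunType mu (lexx 1%E)) = f :> (X -> R).
  by move=> /Lfun1_integrable fL; exists (Lfun_Sub (lexx 1%E) fL).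
exists D; split; last first.
  move=> [z c] Wz; have [F FE] := toV _ (Wi _ Wz).
  have <- : (F : LfunType mu (lexx 1%E)) = z :> (X -> R) by exact: FE.
  by rewrite DE; apply: (lG (F, c)); rewrite /G/= FE.
split.
- by move=> f g /toV[F <-] /toV[G' <-]; rewrite !DE -lD -DE.
- by move=> a f /toV[F <-]; rewrite !DE -lZ -DE.
- by move=> f /toV[F <-]; rewrite DE mul1e -pE lee_fin.
Qed.

(** [h] is the sum of [a n * \1_(F n)] over a cover by sets of finite measure. The denominator
    [1 + mu (F n)] keeps both [a n] and [a n * mu (F n)] below [1 / 2 ^ n.+1], so that the sum is at
    most [1] at each point and in integral. *)
Lemma sigma_finite_pos_integrable {d : measure_display} {X : measurableType d}
    {R : realType} (mu : {measure set X -> \bar R}) : sigma_finite setT mu ->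
  exists h : X -> R, (forall x, 0 < h x) /\ mu.-integrable setT (EFin \o h).
Proof.
move=> [F FT mF].
have F_fin n : mu (F n) \is a fin_num by rewrite ge0_fin_numE//; case: (mF n).
pose a n : R := (2 ^ n.+1)%:R^-1 / (1 + fine (mu (F n))).
have a1 n : 1 <= 1 + fine (mu (F n)) by rewrite lerDl fine_ge0.
have p0 n : 0 < (2 ^ n.+1)%:R :> R by rewrite ltr0n expn_gt0.
have a0 n : 0 < a n.
  by rewrite divr_gt0 ?invr_gt0//; apply: lt_le_trans (a1 n).
have ale n : a n <= 1 / (2 ^ n.+1)%:R.
  rewrite /a div1r ler_pdivrMr; last exact: lt_le_trans (a1 n).
  by rewrite ler_peMr// invr_ge0 ltW.
pose f n x : \bar R := (a n * \1_(F n) x)%:E.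
have f0 n x : (0 <= f n x)%E by rewrite lee_fin mulr_ge0// ltW.
have mf n : measurable_fun setT (f n).
  apply/measurable_EFinP; apply: measurable_funM => //.
  by apply: measurable_indic; case: (mF n).
pose H x : \bar R := (\sum_(n <oo) f n x)%E.
have H0 x : (0 <= H x)%E by exact: nneseries_ge0.
have Hle x : (H x <= 1%:E)%E.
  apply: le_trans (epsilon_trick0 xpredT (@ler01 R)).
  apply: lee_nneseries => // n _; rewrite lee_fin.
  by have an0 := ltW (a0 n); apply: le_trans (ale n); rewrite ler_piMr.
have Hfin x : H x \is a fin_num.
  by rewrite ge0_fin_numE// (le_lt_trans (Hle x))// ltry.
exists (fun x => fine (H x)).
have HE : EFin \o (fun x => fine (H x)) = H.
  by apply/funext => x; rewrite /= fineK.
split=> [x|].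
  have [n _ Fnx] : (\bigcup_n F n) x by rewrite -FT.
  rewrite -lte_fin fineK//; apply: (@lt_le_trans _ _ (f n x)).
    by rewrite lte_fin indicE mem_set// mulr1.
  rewrite /H (@nneseriesD1 _ _ n)//.
  rewrite leeDl//; exact: nneseries_ge0.
rewrite HE; apply/integrableP; split; first exact: ge0_emeasurable_sum.
under eq_integral do rewrite gee0_abs//.
rewrite integral_nneseries//; apply: (@le_lt_trans _ _ 1%:E); last exact: ltry.
apply: le_trans (epsilon_trick0 xpredT (@ler01 R)).
apply: lee_nneseries => [n _ _|n _]; first exact: integral_ge0.
have [mFn _] := mF n.
rewrite /f; under eq_integral do rewrite EFinM.
have an0 := ltW (a0 n); rewrite ge0_integralZl ?lee_fin//; last first.
  exact/measurable_EFinP/measurable_indic.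
rewrite integral_indic// setIT -(fineK (F_fin n)) -EFinM lee_fin /a div1r.
rewrite mulrAC ler_pdivrMr; last exact: lt_le_trans (a1 n).
by rewrite ler_pM2l ?invr_gt0// lerDr.
Qed.

(** * The measure [nu (x) m] *)

Section semidirect_product.
Context {d : measure_display} {T : measurableType d} {R : realType}.
Variables (nu : {measure set T -> \bar R}) (m : R.-pker T ~> T).
Local Open Scope ereal_scope.

(** The set function [nu_otimes_m] of a probability kernel, named so that a measure structure can be
    attached to it. *)
Definition nuxm : set (T * T) -> \bar R := nu_otimes_m nu m.

Let measurable_section C : measurable C ->
  measurable_fun setT (fun x => m x (xsection C x)).
Proof.
by move=> mC; apply: measurable_fun_xsection_finite_kernel; exact: mem_set.
Qed.

Let nuxm0 : nuxm set0 = 0.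
Proof.
by rewrite /nuxm /nu_otimes_m integral0_eq// => x _; rewrite xsection0 measure0.
Qed.

Let nuxm_ge0 C : 0 <= nuxm C.
Proof. exact: integral_ge0. Qed.

Let nuxm_sigma_additive : semi_sigma_additive nuxm.
Proof.
move=> F mF tF mUF; rewrite [X in _ --> X](_ : _ =
    \int[nu]_x (\sum_(n <oo) m x (xsection (F n) x))); last first.
  apply: eq_integral => x _; rewrite xsection_bigcup.
  apply/esym/cvg_lim => //; apply: measure_semi_sigma_additive.
  - by move=> i; exact: measurable_xsection.
  - exact: trivIset_xsection.
  - by apply: bigcup_measurable => i _; exact: measurable_xsection.
apply/cvg_closeP; split.
  by apply: is_cvg_nneseries => n _ _; exact: integral_ge0.
by rewrite closeE// integral_nneseries// => n; exact: measurable_section.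
Qed.

HB.instance Definition _ := isMeasure.Build _ _ R
  nuxm nuxm0 nuxm_ge0 nuxm_sigma_additive.

Let mfst_section (f : T * T -> \bar R) x : measurable_fun setT f ->
  measurable_fun setT (fun y => f (x, y)).
Proof. by move=> mf; exact: measurableT_comp. Qed.

Import HBNNSimple.

(** Tonelli for simple functions, by summing over the values [r]. Negative values have an empty
    preimage and contribute [0] on both sides. *)
Let nuxm_nnsfun (f : {nnsfun (T * T) >-> R}) :
  \int[nuxm]_p (f p)%:E = \int[nu]_x (\int[m x]_y (f (x, y))%:E).
Proof.
have mC r : measurable (f @^-1` [set r]) by [].
have mr x r :
    measurable_fun setT (fun y => (\1_(f @^-1` [set r]) (x, y))%:E : \bar R).
  apply: (mfst_section (fun p => (\1_(f @^-1` [set r]) p)%:E)).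
  exact/measurable_EFinP.
have sectionE x r : \int[m x]_y (r * \1_(f @^-1` [set r]) (x, y))%:E =
    r%:E * m x (xsection (f @^-1` [set r]) x).
  have [r0|r0] := leP 0%R r; last first.
    rewrite preimage_nnfun0// xsection0 measure0 mule0 integral0_eq// => y _.
    by rewrite indic0 mulr0.
  under eq_integral do rewrite EFinM.
  rewrite ge0_integralZl//; congr (_ * _).
  rewrite (eq_integral (fun y => (\1_(xsection (f @^-1` [set r]) x) y)%:E)).
    by rewrite integral_indic ?setIT//; exact: measurable_xsection.
  by move=> y _; rewrite !indicE mem_xsection.
under [in LHS]eq_integral do rewrite fimfunE -fsumEFin//.
rewrite ge0_integral_fsum//; last 2 first.
  - by move=> r; exact/measurable_EFinP/measurableT_comp.
  - by move=> r z _; rewrite EFinM nnfun_muleindic_ge0.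
under [in RHS]eq_integral.
  move=> x _.
  under eq_integral.
    by move=> y _; rewrite fimfunE -fsumEFin//; over.
  rewrite /= ge0_integral_fsum//; last 2 first.
    - by move=> r; under eq_fun do rewrite EFinM; exact: measurable_funeM.
    - by move=> r y _; rewrite EFinM nnfun_muleindic_ge0.
  under eq_fsbigr do rewrite sectionE.
  over.
rewrite /= ge0_integral_fsum//; last 2 first.
  - by move=> r; apply: measurable_funeM; exact: measurable_section.
  - move=> r x _; have [r0|r0] := leP 0%R r; first exact: mule_ge0.
    by rewrite preimage_nnfun0// xsection0 measure0 mule0.
apply: eq_fsbigr => r _.
rewrite integralZl_indic_nnsfun// integral_indic// setIT.
have [r0|r0] := leP 0%R r.
  by rewrite ge0_integralZl//; exact: measurable_section.
rewrite preimage_nnfun0// measure0 mule0 integral0_eq// => x _.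
by rewrite xsection0 measure0 mule0.
Qed.

(** Simple functions increase to [f], and monotone convergence is used three times: for [nuxm], for
    each [m x] and for [nu]. *)
Lemma integral_nuxm (f : T * T -> \bar R) : (forall p, 0 <= f p) ->
  measurable_fun setT f ->
  \int[nuxm]_p f p = \int[nu]_x (\int[m x]_y f (x, y)).
Proof.
move=> f0 mf; pose f_ := nnsfun_approx measurableT mf.
have mf_ x n : measurable_fun setT (fun y => (f_ n (x, y))%:E).
  by apply: (mfst_section (fun p => (f_ n p)%:E)); exact/measurable_EFinP.
have f_cvg p : (f_ n p)%:E @[n --> \oo] --> f p by exact: cvg_nnsfun_approx.
have f_nd p a b : (a <= b)%N -> (f_ a p)%:E <= (f_ b p)%:E.
  by move=> ab; rewrite lee_fin; exact/lefP/nd_nnsfun_approx.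
transitivity (\int[nuxm]_p (lim ((f_ n p)%:E @[n --> \oo]))).
  by apply: eq_integral => p _; apply/esym/cvg_lim.
rewrite monotone_convergence//; last 3 first.
  by move=> n; exact/measurable_EFinP.
  by move=> n p _; rewrite lee_fin.
  by move=> p _ a b; exact: f_nd.
under eq_fun do rewrite nuxm_nnsfun.
transitivity (\int[nu]_x lim ((\int[m x]_y (f_ n (x, y))%:E) @[n --> \oo])).
  rewrite -monotone_convergence//.
  - move=> n.
    apply: (measurable_fun_integral_finite_kernel (fun p => (f_ n p)%:E)).
      by move=> p; rewrite lee_fin.
    exact/measurable_EFinP.
  - by move=> n x _; apply: integral_ge0 => // y _; rewrite lee_fin.
  - move=> x _ a b ab; apply: ge0_le_integral => //.
    + by move=> y _; rewrite lee_fin.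
    + by move=> y _; exact: f_nd.
apply: eq_integral => x _; rewrite -monotone_convergence//.
- by apply: eq_integral => y _; exact/cvg_lim.
- by move=> n y _; rewrite lee_fin.
- by move=> y _ a b; exact: f_nd.
Qed.

Lemma measurable_integral_section (f : T * T -> \bar R) :
  (forall p, 0 <= f p) -> measurable_fun setT f ->
  measurable_fun setT (fun x => \int[m x]_y f (x, y)).
Proof. by move=> f0 mf; exact: measurable_fun_integral_finite_kernel. Qed.

(** Each [m x] has mass [1], so the first marginal of [nuxm] is [nu]. *)
Lemma integral_nuxm_fst (f : T -> \bar R) : (forall x, 0 <= f x) ->
  measurable_fun setT f -> \int[nuxm]_p f p.1 = \int[nu]_x f x.
Proof.
move=> f0 mf; rewrite (integral_nuxm (fun p => f p.1))//; last first.
  exact: measurableT_comp.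
apply: eq_integral => x _ /=; rewrite integral_cst// [X in _ * X]prob_kernel.
by rewrite mule1.
Qed.

(** Fubini, from Tonelli for the positive and negative parts. The splitting [fE] holds at every [x],
    by the definition of the integral. *)
Lemma integrable_nuxm_section (f : T * T -> \bar R) : nuxm.-integrable setT f ->
  [/\ nu.-integrable setT (fun x => \int[m x]_y f (x, y)) &
    \int[nuxm]_p f p = \int[nu]_x (\int[m x]_y f (x, y))].
Proof.
move=> fi; have mf := measurable_int _ fi.
have fip := integrable_funepos measurableT fi.
have fin := integrable_funeneg measurableT fi.
have ip (g : T * T -> \bar R) :
    (forall p, 0 <= g p) -> nuxm.-integrable setT g ->
    nu.-integrable setT (fun x => \int[m x]_y g (x, y)).
  move=> g0 /integrableP[mg gi]; apply/integrableP; split.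
    exact: measurable_integral_section.
  under eq_integral do rewrite gee0_abs ?integral_ge0//.
  rewrite -integral_nuxm//; apply: le_lt_trans gi.
  by under [leRHS]eq_integral do rewrite gee0_abs//.
have fE : (fun x => \int[m x]_y f (x, y)) =
    (fun x => \int[m x]_y f^\+ (x, y)) \- (fun x => \int[m x]_y f^\- (x, y)).
  apply/funext => x /=; rewrite [LHS]integralE; congr (_ - _);
    by apply: eq_integral => y _; rewrite ?funeposE ?funenegE.
split.
  by rewrite fE; apply: integrableB => //; exact: ip.
rewrite fE integralB//; [|exact: ip..].
rewrite [LHS]integralE !integral_nuxm//.
  exact: measurable_int fin.
exact: measurable_int fip.
Qed.

Lemma sigma_finite_nuxm : sigma_finite setT nu -> sigma_finite setT nuxm.
Proof.
move=> [F FT mF]; exists (fun n => F n `*` setT).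
  by rewrite -setX_bigcupl -FT setXTT.
move=> n; have [mFn Fn] := mF n; split; first exact: measurableX.
rewrite (_ : nuxm _ = nu (F n))//.
transitivity (\int[nu]_x (\1_(F n) x)%:E).
  2: by rewrite integral_indic// setIT.
apply: eq_integral => x _; rewrite indicE; case: (boolP (x \in F n)) => xF.
  by rewrite in_xsectionX// [LHS]prob_kernel.
by rewrite notin_xsectionX// measure0.
Qed.

End semidirect_product.

(** * Soft thresholding in [L^2] *)

Section soft_threshold.
Context {R : realType}.
Implicit Types e s t : R.

(** Soft thresholding: [t] minus its projection onto [[- e, e]]. The min-max form makes
    measurability immediate. *)
Definition soft e t := t - Num.max (- e) (Num.min e t).

Let softE e t : 0 <= e -> soft e t =
  if e < t then t - e else if t < - e then t + e else 0.
Proof.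
move=> e0; rewrite /soft; case: (ltP e t) => et.
  have -> : Num.max (- e) e = e by apply/max_idPr; lra.
  by [].
case: (ltP t (- e)) => te; rewrite ?opprK ?subrr//.
Qed.

Lemma soft_le e t : 0 <= e -> `|soft e t| <= `|t|.
Proof.
move=> e0; rewrite softE//; case: ifPn => [et|_].
  by rewrite !ger0_norm; lra.
case: ifPn => [te|_]; last by rewrite normr0.
by rewrite !ler0_norm; lra.
Qed.

(** If the threshold is nonzero then [e < |t|]. This inequality makes thresholds of [L^2] functions
    integrable. *)
Lemma soft_sqr e t : 0 <= e -> e * `|soft e t| <= t ^+ 2.
Proof.
move=> e0; rewrite softE//; case: ifPn => [et|_].
  by rewrite ger0_norm; nra.
case: ifPn => [te|_]; last by rewrite normr0 mulr0 sqr_ge0.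
by rewrite ler0_norm; nra.
Qed.

(** Monotonicity keeps the sign of the gradient of a function under thresholding; [soft_lip] keeps
    its size under control. *)
Lemma soft_nd e s t : 0 <= e -> s <= t -> soft e s <= soft e t.
Proof.
move=> e0 st; rewrite !softE//.
by case: (ltP e s); case: (ltP e t); case: (ltP s (- e));
  case: (ltP t (- e)) => *; lra.
Qed.

Lemma soft_lip e s t : 0 <= e -> `|soft e s - soft e t| <= `|s - t|.
Proof.
move=> e0; wlog st : s t / s <= t => [h|].
  by have [/h//|/ltW/h] := leP s t; rewrite distrC [leRHS]distrC.
have := soft_nd _ _ _ e0 st => sst.
rewrite distrC [leRHS]distrC !ger0_norm; [|lra..].
rewrite !softE//.
by case: (ltP e s); case: (ltP e t); case: (ltP s (- e));
  case: (ltP t (- e)) => *; lra.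
Qed.

Lemma soft_dist e t : 0 <= e -> `|t - soft e t| <= e.
Proof.
move=> e0; rewrite softE// ler_norml.
by case: (ltP e t); case: (ltP t (- e)) => *; apply/andP; split; lra.
Qed.

Lemma soft_cvg t : soft n.+1%:R^-1 t @[n --> \oo] --> t.
Proof.
apply/subr_cvg0/norm_cvg0P.
apply: (@squeeze_cvgr _ _ _ _ (cst 0) (fun n => n.+1%:R^-1)).
- apply: nearW => n; rewrite normr_ge0/= distrC soft_dist// invr_ge0//.
- exact: cvg_cst.
- exact: cvg_harmonic.
Qed.

Lemma measurable_soft e : measurable_fun setT (soft e).
Proof.
apply: measurable_funB => //; apply: measurable_maxr => //.
exact: measurable_minr.
Qed.

End soft_threshold.

Section L2.
Context {d : measure_display} {T : measurableType d} {R : realType}.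
Variable nu : {measure set T -> \bar R}.
Implicit Types u v w : T -> R.

Lemma L2fun_integrable w : L2fun nu w ->
  nu.-integrable setT (fun x => (w x ^+ 2)%:E).
Proof.
move=> [mw wi]; apply/integrableP; split.
  exact/measurable_EFinP/measurable_funX.
by under eq_integral do rewrite gee0_abs ?lee_fin ?sqr_ge0//.
Qed.

Lemma L2fun_le w u v : measurable_fun setT w -> L2fun nu u -> L2fun nu v ->
  (forall x, w x ^+ 2 <= 2 * (u x ^+ 2 + v x ^+ 2)) -> L2fun nu w.
Proof.
move=> mw u2 v2 wuv; split => //.
have ui := L2fun_integrable _ u2; have vi := L2fun_integrable _ v2.
have /integrableP[_] :=
  integrableZl measurableT 2 (integrableD measurableT ui vi).
apply: le_lt_trans; apply: ge0_le_integral => //.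
- by move=> x _; rewrite lee_fin sqr_ge0.
- exact/measurable_EFinP/measurable_funX.
- apply: measurableT_comp => //; apply: measurable_funeM.
  by apply: emeasurable_funD; apply/measurable_EFinP/measurable_funX;
    [case: u2|case: v2].
- by move=> x _; rewrite -EFinD -EFinM/= lee_fin (le_trans (wuv x))// ler_norm.
Qed.

Lemma L2fun0 : L2fun nu (fun=> 0).
Proof. by split => //; rewrite integral0_eq// => x _; rewrite expr0n. Qed.

Lemma L2funD u v : L2fun nu u -> L2fun nu v -> L2fun nu (fun x => u x + v x).
Proof.
move=> u2 v2; have [mu _] := u2; have [mv _] := v2.
apply: L2fun_le u2 v2 _ => [|x]; first exact: measurable_funD.
have := sqr_ge0 (u x - v x); nra.
Qed.

Lemma L2funZ (a : R) u : L2fun nu u -> L2fun nu (fun x => a * u x).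
Proof.
move=> [mu ui]; split; first exact: measurable_funM.
under eq_integral do rewrite exprMn EFinM.
rewrite ge0_integralZl//.
- by rewrite lte_mul_pinfty// lee_fin sqr_ge0.
- exact/measurable_EFinP/measurable_funX.
- by move=> x _; rewrite lee_fin sqr_ge0.
- by rewrite lee_fin sqr_ge0.
Qed.

Lemma L2fun_mul_integrable u v : L2fun nu u -> L2fun nu v ->
  nu.-integrable setT (fun x => (u x * v x)%:E).
Proof.
move=> u2 v2; have ui := L2fun_integrable _ u2; have vi := L2fun_integrable _ v2.
apply: le_integrable (integrableD measurableT ui vi) => //.
  by apply/measurable_EFinP/measurable_funM; [case: u2|case: v2].
move=> x _; rewrite -EFinD/= lee_fin [leRHS]ger0_norm ?addr_ge0 ?sqr_ge0//.
rewrite ler_norml; have := sqr_ge0 (u x - v x); have := sqr_ge0 (u x + v x).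
have := sqr_ge0 (u x); have := sqr_ge0 (v x) => *; apply/andP; split; nra.
Qed.

Lemma L2fun_soft_integrable e w : 0 < e -> L2fun nu w ->
  nu.-integrable setT (EFin \o (soft e \o w)).
Proof.
move=> e0 w2; have wi := L2fun_integrable _ w2.
apply: le_integrable (integrableZl measurableT e^-1 wi) => //.
  apply/measurable_EFinP/measurableT_comp; first exact: measurable_soft.
  by case: w2.
move=> x _; rewrite -EFinM /= lee_fin.
apply: le_trans (ler_norm _).
by rewrite mulrC ler_pdivlMr// mulrC soft_sqr// ltW.
Qed.

Lemma L2fun_indic B : measurable B -> (nu B < +oo)%E ->
  L2fun nu (\1_B) /\ nu.-integrable setT (EFin \o \1_B).
Proof.
move=> mB Boo.
have Bi : (\int[nu]_x (\1_B x)%:E < +oo)%E by rewrite integral_indic// setIT.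
split; last first.
  apply/integrableP; split; first exact/measurable_EFinP.
  rewrite (eq_integral (fun x => (\1_B x)%:E))// => x _.
  by rewrite gee0_abs// lee_fin.
split => //.
under eq_integral do rewrite indicE expr2 -natrM mulnb andbb -indicE.
by [].
Qed.

(** Dominated convergence with the bound [|v * w|], since thresholding decreases absolute values. *)
Lemma L2fun_soft_cvg v w : L2fun nu v -> L2fun nu w ->
  (\int[nu]_x (v x * soft n.+1%:R^-1 (w x))%:E)%E @[n --> \oo] -->
  (\int[nu]_x (v x * w x)%:E)%E.
Proof.
move=> v2 w2; have vwi := L2fun_mul_integrable _ _ v2 w2.
have [mv _] := v2; have [mw _] := w2.
have [] // := @dominated_convergence _ _ _ nu setT measurableT
  (fun n x => (v x * soft n.+1%:R^-1 (w x))%:E) (fun x => (v x * w x)%:E)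
  (fun x => `|(v x * w x)%:E|%E).
- move=> n; apply/measurable_EFinP/measurable_funM => //.
  by apply: measurableT_comp => //; exact: measurable_soft.
- exact/measurable_EFinP/measurable_funM.
- apply: aeW => x _; apply: cvg_EFin; first exact: nearW.
  by apply: cvgMr; exact: soft_cvg.
- exact: integrable_abse.
- apply: aeW => x n _; rewrite lee_fin !normrM ler_wpM2l//.
  by apply: soft_le; rewrite invr_ge0.
Qed.

End L2.

(** * The nonlocal total variation *)

Lemma measurable_swap_pair {d : measure_display} {T : measurableType d} :
  measurable_fun setT (@swap_pair T T).
Proof. exact: measurable_swap. Qed.

Section kernel_weight.
Context {d : measure_display} {T : measurableType d} {R : realType}.
Variable A : set (T * T).

Lemma KA_sym x y : KA A x y = KA A y x :> R.
Proof. by rewrite /KA addrC. Qed.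

Lemma KA_ge0 x y : 0 <= KA A x y :> R.
Proof. by rewrite /KA mulr_ge0// addr_ge0. Qed.

Lemma KA_le1 x y : KA A x y <= 1 :> R.
Proof.
by rewrite /KA !indicE; case: (_ \in A); case: (_ \in A) => /=; lra.
Qed.

Lemma measurable_KA : measurable A ->
  measurable_fun setT (fun p : T * T => KA A p.1 p.2 : R).
Proof.
move=> mA; apply: measurable_funM => //; apply: measurable_funD.
  rewrite (_ : (fun p => _) = \1_A); first exact: measurable_indic.
  by apply/funext => -[].
rewrite (_ : (fun p => _) = \1_A \o swap_pair)//.
apply: measurableT_comp; first exact: measurable_indic.
exact: measurable_swap_pair.
Qed.

End kernel_weight.

(** * Consequences of reversibility *)

Section reversible_walk.
Context {d : measure_display} {T : measurableType d} {R : realType}.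
Variables (nu : {measure set T -> \bar R}) (m : R.-pker T ~> T).
Hypothesis rev : rws_reversible nu m.
Local Notation mu := (nuxm nu m).
Implicit Types (f : T * T -> \bar R).

(** Reversibility says that [nu (x) m] is its own image under the swap; the rest is a change of
    variables. *)
Let ge0_integral_swap f : (forall p, (0 <= f p)%E) -> measurable_fun setT f ->
  (\int[mu]_p f (swap_pair p) = \int[mu]_p f p)%E.
Proof.
move=> f0 mf.
pose sw : {mfun (T * T)%type >-> (T * T)%type} :=
  HB.pack (@swap_pair T T)
    (isMeasurableFun.Build _ _ _ _ _ (@measurable_swap_pair _ T)).
transitivity (\int[pushforward mu sw]_p f p)%E.
  by rewrite (ge0_integral_pushforward (phi := sw) measurable_swap_pair).
apply: eq_measure_integral => C mC _.
by rewrite /pushforward /= /nuxm [RHS]rev.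
Qed.

Lemma integral_swap f : measurable_fun setT f ->
  (\int[mu]_p f (swap_pair p) = \int[mu]_p f p)%E.
Proof.
move=> mf; rewrite [LHS]integralE [RHS]integralE; congr (_ - _)%E.
  rewrite -(ge0_integral_swap f^\+%E)//; last exact: measurable_funepos.
  by apply: eq_integral => p _; rewrite !funeposE.
rewrite -(ge0_integral_swap f^\-%E)//; last exact: measurable_funeneg.
by apply: eq_integral => p _; rewrite !funenegE.
Qed.

Lemma integrable_swap f : mu.-integrable setT f ->
  mu.-integrable setT (fun p => f (swap_pair p)).
Proof.
move=> /integrableP[mf fi]; apply/integrableP; split.
  by apply: measurableT_comp => //; exact: measurable_swap_pair.
rewrite (integral_swap (fun p => `|f p|%E))//; exact: measurableT_comp.
Qed.

Lemma integrable_fst (w : T -> R) : nu.-integrable setT (EFin \o w) ->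
  mu.-integrable setT (fun p => (w p.1)%:E).
Proof.
move=> /integrableP[mw wi]; apply/integrableP; split.
  by apply: (measurableT_comp mw); exact: measurable_fst.
rewrite (integral_nuxm_fst _ _ (fun x => `|(w x)%:E|%E))//.
exact: measurableT_comp.
Qed.

Lemma integrable_snd (w : T -> R) : nu.-integrable setT (EFin \o w) ->
  mu.-integrable setT (fun p => (w p.2)%:E).
Proof. by move=> /integrable_fst/integrable_swap. Qed.

(** The nonnegative function [m x (xsection N x)] has integral [0], hence vanishes for almost every
    [x]. *)
Lemma ae_nu_m_section (P : T * T -> Prop) : ae_nu_m nu m P ->
  {ae nu, forall x, {ae m x, forall y, P (x, y)}}.
Proof.
move=> [N [mN N0 PN]].
have mNx : measurable_fun setT (fun x => m x (xsection N x)).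
  by apply: measurable_fun_xsection_finite_kernel; exact: mem_set.
have : (\int[nu]_x `|m x (xsection N x)| = 0)%E.
  by rewrite -[RHS]N0; apply: eq_integral => x _; rewrite gee0_abs.
move=> /(ae_eq_integral_abs _ measurableT mNx); apply: filterS => x /(_ I) Nx0.
exists (xsection N x); split => //; first exact: measurable_xsection.
by move=> y Py; rewrite /xsection/=; apply: mem_set; exact: PN.
Qed.

End reversible_walk.

(** * The energy as an integral over pairs *)

Section nonlocal_total_variation.
Context {d : measure_display} {T : measurableType d} {R : realType}.
Variables (nu : {measure set T -> \bar R}) (m : R.-pker T ~> T).
Variable A : set (T * T).
Hypotheses (rev : rws_reversible nu m) (mA : measurable A).
Local Notation mu := (nuxm nu m).
Local Notation K p := (KA A p.1 p.2).
Local Notation F := (F_A1m nu m A).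
Implicit Types (u v w : T -> R) (g : T * T -> R).

Let mK : measurable_fun setT (fun p : T * T => K p : R) := measurable_KA A mA.

Lemma measurable_grad w : measurable_fun setT w ->
  measurable_fun setT (fun p : T * T => w p.2 - w p.1).
Proof.
by move=> mw; apply: measurable_funB; apply: measurableT_comp.
Qed.

Lemma measurable_energy w : measurable_fun setT w ->
  measurable_fun setT (fun p : T * T => (`|w p.2 - w p.1| * K p)%:E).
Proof.
move=> mw; apply/measurable_EFinP/measurable_funM => //.
by apply: measurableT_comp => //; exact: measurable_grad.
Qed.

Lemma energy_ge0 w p : (0 <= (`|w p.2 - w p.1| * K p)%:E)%E.
Proof. by rewrite lee_fin mulr_ge0// KA_ge0. Qed.

Lemma F_A1mE w : measurable_fun setT w ->
  F w = (2^-1%:E * \int[mu]_p (`|w p.2 - w p.1| * K p)%:E)%E.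
Proof.
move=> mw; rewrite (integral_nuxm _ _ (fun p => (`|w p.2 - w p.1| * K p)%:E))//.
  by move=> p; exact: energy_ge0.
exact: measurable_energy.
Qed.

Lemma F_A1m_ge0 w : measurable_fun setT w -> (0 <= F w)%E.
Proof.
move=> mw; rewrite F_A1mE// mule_ge0 ?lee_fin ?invr_ge0//.
by apply: integral_ge0 => p _; exact: energy_ge0.
Qed.

Lemma le_F_A1m w w' : measurable_fun setT w -> measurable_fun setT w' ->
  (forall x y, `|w y - w x| <= `|w' y - w' x|) -> (F w <= F w')%E.
Proof.
move=> mw mw' ww'; rewrite !F_A1mE// lee_wpmul2l ?lee_fin ?invr_ge0//.
apply: ge0_le_integral => //.
- by move=> p _; exact: energy_ge0.
- exact: measurable_energy.
- exact: measurable_energy.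
- by move=> p _; rewrite lee_fin ler_wpM2r// KA_ge0.
Qed.

Lemma F_A1mD w w' : measurable_fun setT w -> measurable_fun setT w' ->
  (F (fun x => w x + w' x)%R <= F w + F w')%E.
Proof.
move=> mw mw'; rewrite !F_A1mE//; last exact: measurable_funD.
rewrite -ge0_muleDr; [|by apply: integral_ge0 => p _; exact: energy_ge0..].
rewrite lee_wpmul2l ?lee_fin ?invr_ge0//.
rewrite -ge0_integralD//; last 4 first.
- by move=> p _; exact: energy_ge0.
- exact: measurable_energy.
- by move=> p _; exact: energy_ge0.
- exact: measurable_energy.
apply: ge0_le_integral => //.
- by move=> p _; exact: (energy_ge0 (fun x => w x + w' x)).
- by apply: (measurable_energy (fun x => w x + w' x)); exact: measurable_funD.
- by apply: emeasurable_funD; exact: measurable_energy.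
- move=> p _; rewrite -EFinD lee_fin -mulrDl ler_wpM2r ?KA_ge0//.
  by rewrite opprD addrACA ler_normD.
Qed.

(** Both [w p.1] and [w p.2] are integrable, the second one by reversibility, and [0 <= K <= 1]. *)
Lemma integrable_grad w : nu.-integrable setT (EFin \o w) ->
  mu.-integrable setT (fun p => (K p * (w p.2 - w p.1))%:E).
Proof.
move=> wi; have /measurable_EFinP mw := measurable_int _ wi.
have := integrableB measurableT
  (integrable_snd nu m rev _ wi) (integrable_fst nu m _ wi).
apply: le_integrable => //.
  by apply/measurable_EFinP/measurable_funM => //; exact: measurable_grad.
move=> p _; rewrite -EFinB/= lee_fin normrM ger0_norm ?KA_ge0//.
by rewrite ler_piMl// KA_le1.
Qed.

Lemma integrable_energy w : measurable_fun setT w -> (F w < +oo)%E ->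
  mu.-integrable setT (fun p => (`|w p.2 - w p.1| * K p)%:E).
Proof.
move=> mw Fw; apply/integrableP; split; first exact: measurable_energy.
under eq_integral do rewrite gee0_abs ?energy_ge0//.
move: Fw; rewrite F_A1mE//.
case: (\int[_]_p _)%E => [r _|/=|//]; first exact: ltry.
by rewrite gt0_muley// lte_fin invr_gt0.
Qed.

(** * Antisymmetric fluxes *)

Section flux.
Variable g : T * T -> R.
Hypotheses (mg : measurable_fun setT g) (g1 : forall p, `|g p| <= 1).
Hypothesis gA : forall x y, g (x, y) = - g (y, x).

Let gK p := g p * K p.

Let mgK : measurable_fun setT gK.
Proof. exact: measurable_funM. Qed.

Let gK1 p : `|gK p| <= 1.
Proof.
rewrite normrM -[leRHS]mulr1 ler_pM//.
by rewrite ger0_norm ?KA_ge0// KA_le1.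
Qed.

Let gK_swap p : gK (swap_pair p) = - gK p.
Proof. by case: p => x y; rewrite /gK /swap_pair/= gA (KA_sym A y) mulNr. Qed.

Let gK_fst_integrable w : nu.-integrable setT (EFin \o w) ->
  mu.-integrable setT (fun p => (w p.1 * gK p)%:E).
Proof.
move=> wi; have /measurable_EFinP mw := measurable_int _ wi.
apply: le_integrable (integrable_fst nu m _ wi) => //.
  apply/measurable_EFinP/measurable_funM => //.
  by apply: measurableT_comp => //; exact: measurable_fst.
by move=> p _; rewrite lee_fin normrM ler_piMr.
Qed.

(** [K] is symmetric, so [gK] is antisymmetric and the swap turns [w p.2 * gK p] into
    [- (w p.1 * gK p)]. Integrability of [w] allows the difference to be split. *)
Lemma integral_grad_flux w : nu.-integrable setT (EFin \o w) ->
  (\int[mu]_p ((w p.2 - w p.1) * gK p)%:E =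
   - (2%:E * \int[mu]_p (w p.1 * gK p)%:E))%E.
Proof.
move=> wi; have i1 := gK_fst_integrable w wi.
have e2 : (fun p => (w p.2 * gK p)%:E) =
    (fun p => - (w (swap_pair p).1 * gK (swap_pair p))%:E)%E.
  by apply/funext => p; rewrite gK_swap -EFinN mulrN opprK.
have i2 := integrable_swap nu m rev _ i1.
have i2N := integrableN i2.
transitivity (\int[mu]_p ((w p.2 * gK p)%:E - (w p.1 * gK p)%:E))%E.
  by apply: eq_integral => p _; rewrite mulrBl.
rewrite integralB//; last by rewrite e2.
have -> : (\int[mu]_p (w p.2 * gK p)%:E = - \int[mu]_p (w p.1 * gK p)%:E)%E.
  rewrite e2 integralN; last exact: integrable_add_def.
  rewrite (integral_swap nu m rev (fun p => (w p.1 * gK p)%:E))//.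
  exact: measurable_int i1.
have := integrable_fin_num measurableT i1.
case: (\int[mu]_p (w p.1 * gK p)%:E)%E => // r _.
by rewrite -EFinN -EFinB -EFinM -EFinN; congr EFin; lra.
Qed.

(** [gK] is bounded and [m x] is finite, so the section of [gK] is integrable and the constant [w x]
    can be moved inside. *)
Lemma flux_pairingE w x :
  ((w x)%:E * \int[m x]_y (g (x, y) * KA A x y)%:E =
   \int[m x]_y (w x * gK (x, y))%:E)%E.
Proof.
rewrite -integralZl//.
apply: (measurable_bounded_integrable (f := fun y => gK (x, y))) => //.
- by rewrite [ltLHS]prob_kernel ltry.
- exact: measurableT_comp.
- exists 1; split => // r r1 y _; exact: le_trans (gK1 _) (ltW r1).
Qed.

Lemma integral_div_flux w : nu.-integrable setT (EFin \o w) ->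
  nu.-integrable setT
    (fun x => (w x)%:E * \int[m x]_y (g (x, y) * KA A x y)%:E)%E /\
  (\int[nu]_x ((w x)%:E * \int[m x]_y (g (x, y) * KA A x y)%:E) =
   \int[mu]_p (w p.1 * gK p)%:E)%E.
Proof.
move=> wi; under eq_fun do rewrite flux_pairingE.
by have [? ->] := integrable_nuxm_section nu m _ (gK_fst_integrable w wi).
Qed.

Lemma measurable_div_flux :
  measurable_fun setT (fun x => \int[m x]_y (g (x, y) * KA A x y)%:E)%E.
Proof.
rewrite (_ : (fun x => _) = (fun x =>
    \int[m x]_y (EFin \o gK)^\+ (x, y) - \int[m x]_y (EFin \o gK)^\- (x, y))%E).
  by apply: emeasurable_funB; apply: measurable_integral_section => //;
    [apply: measurable_funepos|apply: measurable_funeneg]; exact/measurable_EFinP.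
apply/funext => x /=; rewrite [LHS]integralE; congr (_ - _)%E;
  by apply: eq_integral => y _; rewrite ?funeposE ?funenegE.
Qed.

(** * Pairing the divergence of a flux with functions *)

Section divergence.
Variable v : T -> R.
Hypothesis v2 : L2fun nu v.
Hypothesis vE : {ae nu, forall x,
  (v x)%:E = (- \int[m x]_y (g (x, y) * KA A x y)%:E)%E}.

Let mv : measurable_fun setT v. Proof. by case: v2. Qed.

Lemma integration_by_parts w : nu.-integrable setT (EFin \o w) ->
  (\int[nu]_x (v x * w x)%:E =
   2^-1%:E * \int[mu]_p ((w p.2 - w p.1) * gK p)%:E)%E.
Proof.
move=> wi; have /measurable_EFinP mw := measurable_int _ wi.
have i1 := gK_fst_integrable w wi.
have [di dE] := integral_div_flux _ wi.
rewrite integral_grad_flux//.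
transitivity (- \int[nu]_x ((w x)%:E * \int[m x]_y (g (x, y) * KA A x y)%:E))%E.
  rewrite -integralN; last exact: integrable_add_def.
  apply: ae_eq_integral => //.
  - exact/measurable_EFinP/measurable_funM.
  - by apply: measurableT_comp => //; exact: measurable_int di.
  - by apply: filterS vE => x vx _; rewrite EFinM vx mulNe muleC.
rewrite dE; have := integrable_fin_num measurableT i1.
case: (\int[mu]_p (w p.1 * gK p)%:E)%E => // r _.
by rewrite -EFinM -EFinN; congr EFin; lra.
Qed.

Lemma soft_parts w n : L2fun nu w ->
  (\int[nu]_x (v x * soft n.+1%:R^-1 (w x))%:E = 2^-1%:E * \int[mu]_p
    ((soft n.+1%:R^-1 (w p.2) - soft n.+1%:R^-1 (w p.1)) * gK p)%:E)%E.
Proof.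
move=> w2; apply: (integration_by_parts (soft n.+1%:R^-1 \o w)).
by apply: L2fun_soft_integrable => //; rewrite invr_gt0.
Qed.

Let mdiff w n : measurable_fun setT w -> measurable_fun setT
  (fun p : T * T => (soft n.+1%:R^-1 (w p.2) - soft n.+1%:R^-1 (w p.1)) * gK p).
Proof.
move=> mw; apply: measurable_funM => //.
apply: (measurable_grad (soft n.+1%:R^-1 \o w)).
by apply: measurableT_comp => //; exact: measurable_soft.
Qed.

Let msoft w n : measurable_fun setT w ->
  measurable_fun setT (soft n.+1%:R^-1 \o w).
Proof. by move=> mw; apply: measurableT_comp => //; exact: measurable_soft. Qed.

Let e_ge0 n : 0 <= n.+1%:R^-1 :> R. Proof. by rewrite invr_ge0. Qed.

(** For a soft threshold [w'] of [w], integration by parts and [|g| <= 1] bound the pairing of [v]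
    with [w'] by [F w'], and [F w' <= F w] because thresholding is 1-Lipschitz. *)
Lemma F_A1m_ge_pairing w : L2fun nu w -> (\int[nu]_x (v x * w x)%:E <= F w)%E.
Proof.
move=> w2; have [mw _] := w2.
rewrite -(cvg_lim _ (L2fun_soft_cvg nu _ _ v2 w2))//.
apply: lime_le; first by apply/cvg_ex; eexists; exact: L2fun_soft_cvg.
apply: nearW => n; rewrite soft_parts//.
apply: (@le_trans _ _ (F (soft n.+1%:R^-1 \o w))); last first.
  apply: le_F_A1m => //; first exact: msoft.
  by move=> x y; exact: soft_lip.
rewrite F_A1mE; last exact: msoft.
rewrite lee_wpmul2l ?lee_fin ?invr_ge0//.
apply: (le_trans (lee_abs _)).
apply: (le_trans (le_abse_integral _ measurableT _)).
  by apply/measurable_EFinP; exact: mdiff.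
apply: ge0_le_integral => //.
- by apply: measurableT_comp => //; apply/measurable_EFinP; exact: mdiff.
- by apply: (measurable_energy (soft n.+1%:R^-1 \o w)); exact: msoft.
- move=> p _; rewrite lee_fin/= normrM ler_wpM2l//.
  rewrite normrM (ger0_norm (KA_ge0 _ _ _)) ler_piMl// KA_ge0//.
Qed.

(** [F u] is not known to be finite here, so Fatou's lemma passes to the limit: [F u] is at most the
    lower limit of the energies of the thresholds, and each of these equals the pairing of [v] with
    the threshold. *)
Lemma F_A1m_le_pairing u : L2fun nu u ->
  {ae mu, forall p, (u p.2 - u p.1) * gK p = `|u p.2 - u p.1| * K p} ->
  (F u <= \int[nu]_x (v x * u x)%:E)%E.
Proof.
move=> u2 gu; have [mu' _] := u2.
pose f n (p : T * T) : \bar R :=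
  (`|soft n.+1%:R^-1 (u p.2) - soft n.+1%:R^-1 (u p.1)| * K p)%:E.
have Fsoft n : (\int[nu]_x (v x * soft n.+1%:R^-1 (u x))%:E =
    2^-1%:E * \int[mu]_p f n p)%E.
  rewrite soft_parts//; congr (_ * _)%E; apply: ae_eq_integral => //.
  - by apply/measurable_EFinP; exact: mdiff.
  - by apply: (measurable_energy (soft n.+1%:R^-1 \o u)); exact: msoft.
  (* Where the gradient of [u] is nonzero, [gp] forces [gK p] to be [K p] up to its sign. The
     gradient of the threshold has the same sign or vanishes, so it satisfies the same identity. *)
  - apply: filterS gu => p gp _; congr EFin.
    have nd1 := soft_nd n.+1%:R^-1 (u p.1) (u p.2) (e_ge0 n).
    have nd2 := soft_nd n.+1%:R^-1 (u p.2) (u p.1) (e_ge0 n).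
    have [lt12|lt21|->] := ltgtP (u p.1) (u p.2); last first.
    + by rewrite subrr normr0 !mul0r.
    + have d0 : u p.2 - u p.1 < 0 by lra.
      have dn0 : u p.2 - u p.1 != 0 by rewrite lt_eqF.
      have sd := nd2 (ltW lt21).
      move: gp; rewrite (ltr0_norm d0) mulNr -mulrN => /(mulfI dn0) ->.
      by rewrite ler0_norm; lra.
    + have d0 : 0 < u p.2 - u p.1 by lra.
      have dn0 : u p.2 - u p.1 != 0 by rewrite gt_eqF.
      have sd := nd1 (ltW lt12).
      move: gp; rewrite (gtr0_norm d0) => /(mulfI dn0) ->.
      by rewrite ger0_norm; lra.
rewrite F_A1mE//.
have -> : (\int[mu]_p (`|u p.2 - u p.1| * K p)%:E =
    \int[mu]_p limn_einf (f ^~ p))%E.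
  apply: eq_integral => p _; apply/esym.
  have fcvg : f ^~ p @ \oo --> (`|u p.2 - u p.1| * K p)%:E.
    apply: cvg_EFin; first exact: nearW.
    apply: cvgMl; apply: cvg_norm; apply: cvgB; exact: soft_cvg.
  rewrite is_cvg_limn_einfE; first exact/cvg_lim.
  by apply/cvg_ex; eexists; exact: fcvg.
apply: (@le_trans _ _ (2^-1%:E * limn_einf (fun n => \int[mu]_p f n p)))%E.
  rewrite lee_wpmul2l ?lee_fin ?invr_ge0//; apply: fatou => //.
    move=> n; apply: (measurable_energy (soft n.+1%:R^-1 \o u)).
    exact: msoft.
  by move=> n p _; exact: (energy_ge0 (soft n.+1%:R^-1 \o u)).
have cI : (\int[mu]_p f n p)%E @[n --> \oo] -->
    (2%:E * \int[nu]_x (v x * u x)%:E)%E.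
  rewrite (_ : (fun n => _) = (fun n =>
      2%:E * \int[nu]_x (v x * soft n.+1%:R^-1 (u x))%:E)%E).
    by apply: cvgeZl => //; exact: L2fun_soft_cvg.
  by apply/funext => n; rewrite Fsoft muleA -EFinM mulfV// mul1e.
rewrite is_cvg_limn_einfE; last by apply/cvg_ex; eexists; exact: cI.
by rewrite (cvg_lim _ cI)// muleA -EFinM mulVf// mul1e.
Qed.

(** Once [F u] is finite, the energy density of [u] dominates the integrands of [soft_parts], and
    integration by parts extends to [u] by dominated convergence on both sides. *)
Lemma pairing_flux u : L2fun nu u -> (F u < +oo)%E ->
  (\int[nu]_x (v x * u x)%:E =
   2^-1%:E * \int[mu]_p ((u p.2 - u p.1) * gK p)%:E)%E.
Proof.
move=> u2 Fu; have [mu' _] := u2.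
have Ei := integrable_energy _ mu' Fu.
have [] := @dominated_convergence _ _ _ mu setT measurableT
  (fun n p => ((soft n.+1%:R^-1 (u p.2) - soft n.+1%:R^-1 (u p.1)) * gK p)%:E)
  (fun p => ((u p.2 - u p.1) * gK p)%:E) (fun p => (`|u p.2 - u p.1| * K p)%:E).
- by move=> n; apply/measurable_EFinP; exact: mdiff.
- by apply/measurable_EFinP/measurable_funM => //; exact: measurable_grad.
- apply: aeW => p _; apply: cvg_EFin; first exact: nearW.
  by apply: cvgMl; apply: cvgB; exact: soft_cvg.
- exact: Ei.
- apply: aeW => p n _; rewrite lee_fin/= normrM normrM (ger0_norm (KA_ge0 _ _ _)).
  rewrite ler_pM//; first by rewrite mulr_ge0// KA_ge0.
    exact: soft_lip.
  by rewrite ler_piMl// KA_ge0.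
move=> _ _ cI.
have := L2fun_soft_cvg nu _ _ v2 u2.
under eq_fun do rewrite soft_parts//.
move=> /(cvg_unique _); apply => //.
exact: cvgeZl.
Qed.

End divergence.
End flux.
End nonlocal_total_variation.

(** * The multivalued sign as an equation *)

Lemma sign_setE {R : realType} (r s : R) : sign_set r s -> r * s = `|r|.
Proof.
rewrite /sign_set; case: ltgtP => [r0 ->|r0 ->|<- _].
- by rewrite mulr1 gtr0_norm.
- by rewrite mulrN1 ltr0_norm.
- by rewrite mul0r normr0.
Qed.

Lemma sign_set_mem {R : realType} (r s : R) : `|s| <= 1 -> r * s = `|r| ->
  sign_set r s.
Proof.
rewrite /sign_set => s1; case: ltgtP => [r0|r0|<- _].
3: by move: s1; rewrite ler_norml.
- by rewrite gtr0_norm// => rs; apply: (mulfI (lt0r_neq0 r0)); rewrite rs mulr1.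
- by rewrite ltr0_norm// => rs; apply: (mulfI (ltr0_neq0 r0)); rewrite rs mulrN1.
Qed.

(** A selection of the multivalued sign, with value [0] at [0], for the pairs where [K] vanishes. *)
Lemma sign_set_sgr {R : realType} (r : R) : sign_set r (Num.sg r).
Proof.
apply: sign_set_mem; last by rewrite mulrC -normrEsg.
by rewrite normr_sg; case: (r != 0).
Qed.

(** * From the subdifferential to a flux *)

Section theorem.
Context {d : measure_display} {T : measurableType d} {R : realType}.
Variables (nu : {measure set T -> \bar R}) (m : R.-pker T ~> T).
Variable A : set (T * T).
Hypotheses (rev : rws_reversible nu m) (mA : measurable A).
Local Notation mu := (nuxm nu m).
Local Notation K p := (KA A p.1 p.2).
Local Notation F := (F_A1m nu m A).
Implicit Types (u v w : T -> R) (g : T * T -> R).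

(** Testing at [0] gives the first inequality, which makes [F u] finite. Testing at [u + w] and
    using the subadditivity of [F] gives the second after [F u] is cancelled. Conversely, the two
    inequalities add up to the subgradient inequality. *)
Lemma subdiff_L2P u v : L2fun nu u -> L2fun nu v ->
  subdiff_L2 nu F u v <->
  (F u <= \int[nu]_x (v x * u x)%:E)%E /\
  forall w, L2fun nu w -> (\int[nu]_x (v x * w x)%:E <= F w)%E.
Proof.
move=> u2 v2; have [mu' _] := u2.
have pair_fin w : L2fun nu w -> (\int[nu]_x (v x * w x)%:E)%E \is a fin_num.
  by move=> w2; exact/integrable_fin_num/L2fun_mul_integrable.
have pairB w : L2fun nu w -> (\int[nu]_x (v x * (w x - u x))%:E =
    \int[nu]_x (v x * w x)%:E - \int[nu]_x (v x * u x)%:E)%E.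
  move=> w2; rewrite -integralB//; [|exact: L2fun_mul_integrable..].
  by apply: eq_integral => x _; rewrite mulrBr.
split=> [sub|[Fu Fge] w w2]; last first.
  rewrite pairB//; apply: le_trans (Fge _ w2).
  by rewrite addeCA geeDl// sube_le0.
have Fu : (F u <= \int[nu]_x (v x * u x)%:E)%E.
  have := sub _ (L2fun0 nu); rewrite pairB; last exact: L2fun0.
  rewrite (_ : F (fun=> 0) = 0%E); last first.
    rewrite F_A1mE// integral0_eq ?mule0// => p _.
    by rewrite subrr normr0 mul0r.
  rewrite [X in (_ + (X - _))%E]integral0_eq; last by move=> x _; rewrite mulr0.
  by rewrite add0e sube_le0.
split=> // w w2; have [mw _] := w2.
have Fu_fin : F u \is a fin_num.
  rewrite ge0_fin_numE; last exact: F_A1m_ge0.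
  by apply: le_lt_trans Fu _; rewrite ltey_eq pair_fin.
have := sub _ (L2funD nu _ _ u2 w2).
rewrite (eq_integral (fun x => (v x * w x)%:E)); last first.
  by move=> x _; rewrite addrAC subrr add0r.
move=> /le_trans /(_ (F_A1mD nu m A mA _ _ mu' mw)).
by rewrite leeD2lE.
Qed.

Lemma exists_flux v : sigma_finite setT nu -> L2fun nu v ->
  (forall w, L2fun nu w -> (\int[nu]_x (v x * w x)%:E <= F w)%E) ->
  exists g, [/\ measurable_fun setT g, forall p, `|g p| <= 1,
    forall x y, g (x, y) = - g (y, x) &
    {ae nu, forall x, (v x)%:E = (- \int[m x]_y (g (x, y) * KA A x y)%:E)%E}].
Proof.
move=> sf v2 Fge; have [mv _] := v2.
(* The functional is prescribed on gradients of functions that are integrable as well as in [L^2],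
   so that [K * grad w] is in [L^1]. The factor [2] compensates the [1/2] in [F]. *)
pose W : set ((T * T -> R) * R) := [set z | exists w, [/\ L2fun nu w,
  nu.-integrable setT (EFin \o w), z.1 = (fun p => K p * (w p.2 - w p.1)) &
  z.2%:E = (2%:E * \int[nu]_x (v x * w x)%:E)%E]].
have [D [LD DW]] : exists D, L1_functional mu 1 D /\ forall z, W z -> D z.1 = z.2.
  apply: L1_functional_extension.
  - exists (fun=> 0); split => //; first exact: L2fun0.
    + exact: integrable0.
    + by apply/funext => p /=; rewrite subrr mulr0.
    + by rewrite integral0_eq ?mule0// => x _; rewrite mulr0.
  - move=> [z1 c1] [z2 c2] [w1 [w12 w1i /= -> c1E]] [w2 [w22 w2i /= -> c2E]].
    exists (fun x => w1 x + w2 x); split => //.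
    + exact: L2funD.
    + exact: integrable_addR.
    + by apply/funext => p /=; ring.
    + have i1 := L2fun_mul_integrable nu v w1 v2 w12.
      have i2 := L2fun_mul_integrable nu v w2 v2 w22.
      rewrite /= EFinD c1E c2E -muleDr//; last first.
        exact/fin_num_adde_defr/integrable_fin_num.
      rewrite -integralD//; congr (_ * _)%E; apply: eq_integral => x _.
      by rewrite mulrDr.
  - move=> a [z c] [w [w2 wi /= -> cE]].
    exists (fun x => a * w x); split => //.
    + exact: L2funZ.
    + exact: integrable_mulR.
    + by apply/funext => p /=; ring.
    + rewrite /= EFinM cE muleCA -integralZl//; last exact: L2fun_mul_integrable.
      by congr (_ * _)%E; apply: eq_integral => x _; rewrite -EFinM mulrCA.
  - by move=> z [w [_ wi -> _]]; exact: integrable_grad.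
  - move=> z [w [w2 wi -> ->]]; have [mw _] := w2.
    apply: (@le_trans _ _ (2%:E * F w)%E); first exact/lee_wpmul2l/Fge.
    rewrite F_A1mE// muleA -EFinM mulfV// mul1e.
    rewrite le_eqVlt; apply/orP; left; apply/eqP; apply: eq_integral => p _.
    by rewrite normrM (ger0_norm (KA_ge0 _ _ _)) mulrC.
have [h [h0 hi]] := sigma_finite_pos_integrable _ sf.
pose musf : {sigma_finite_measure set (T * T)%type -> \bar R} :=
  HB.pack mu (Measure_isSigmaFinite.Build _ _ _ mu (sigma_finite_nuxm nu m sf)).
have [g0 [mg0 g01 Dg0]] : exists g0 : T * T -> R, [/\ measurable_fun setT g0,
    forall x, `|g0 x| <= 1 &
    forall f, mu.-integrable setT (EFin \o f) ->
      (D f)%:E = (\int[mu]_x (f x * g0 x)%:E)%E].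
  (* The weight depends on the first variable only; it is integrable since the first marginal is
     [nu]. *)
  apply: (L1_dual musf (fun p => h p.1) D) => //.
  exact: integrable_fst.
(* The antisymmetric part of [g0], still bounded by [1]. *)
pose g p := 2^-1 * (g0 p - g0 (swap_pair p)).
have mg : measurable_fun setT g.
  apply: measurable_funM => //; apply: measurable_funB => //.
  by apply: measurableT_comp => //; exact: measurable_swap_pair.
have g1 p : `|g p| <= 1.
  have := g01 p; have := g01 (swap_pair p).
  rewrite /g !ler_norml => /andP[? ?] /andP[? ?]; apply/andP; split; lra.
have gA x y : g (x, y) = - g (y, x) by rewrite /g /swap_pair/=; ring.
have test w : L2fun nu w -> nu.-integrable setT (EFin \o w) ->
    (\int[nu]_x ((w x)%:E * (v x)%:E) =
     \int[nu]_x ((w x)%:E * - \int[m x]_y (g (x, y) * KA A x y)%:E))%E.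
  move=> w2 wi; have [mw _] := w2.
  have vwi := L2fun_mul_integrable nu v w v2 w2.
  have [di dE] := integral_div_flux nu m A mA g mg g1 w wi.
  pose f p := K p * (w p.2 - w p.1) * g0 p.
  have fi : mu.-integrable setT (EFin \o f).
    have Ki := integrable_grad nu m A rev mA w wi.
    have /measurable_EFinP mKw := measurable_int _ Ki.
    apply: le_integrable Ki => //; first exact/measurable_EFinP/measurable_funM.
    by move=> p _; rewrite lee_fin normrM ler_piMr.
  have fsE := integral_swap nu m rev _ (measurable_int _ fi).
  have fsi := integrable_swap nu m rev _ fi.
  have vwE : (2%:E * \int[nu]_x (v x * w x)%:E = \int[mu]_p (f p)%:E)%E.
    rewrite -Dg0; last exact: integrable_grad.
    have vw_fin := integrable_fin_num measurableT vwi.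
    rewrite (DW (_, 2 * fine (\int[nu]_x (v x * w x)%:E)%E))/=.
      by rewrite EFinM fineK.
    by exists w; split => //=; rewrite EFinM fineK.
  (* [K * grad w] is antisymmetric, so averaging [f] with its swap replaces [g0] by [g];
     reversibility leaves the integral unchanged. *)
  have gE : (\int[mu]_p (f p)%:E =
      \int[mu]_p ((w p.2 - w p.1) * (g p * K p))%:E)%E.
    transitivity (\int[mu]_p (2^-1%:E * ((f p)%:E + (f (swap_pair p))%:E)))%E.
      rewrite integralZl//; last exact: integrableD.
      rewrite integralD// fsE.
      have := integrable_fin_num measurableT fi.
      case: (\int[mu]_p (EFin \o f) p)%E => // r _.
      by rewrite -EFinD -EFinM; congr EFin; lra.
    apply: eq_integral => p _; rewrite -EFinD -EFinM; congr EFin.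
    by rewrite /f /g /= (KA_sym A p.2); ring.
  rewrite gE integral_grad_flux// -dE in vwE.
  under [RHS]eq_integral do rewrite muleN.
  rewrite integralN; last exact: integrable_add_def.
  under [LHS]eq_integral do rewrite muleC -EFinM.
  move: vwE (integrable_fin_num measurableT vwi) (integrable_fin_num measurableT di).
  case: (\int[nu]_x (v x * w x)%:E)%E => // a; case: (\int[nu]_x (_ * _))%E => // b.
  rewrite -!EFinM -EFinN => -[ab] _ _.
  by rewrite -EFinN; congr EFin; lra.
exists g; split => //.
have [Fn FnT mF] := sf.
(* On each [Fn n], of finite measure, [v] is integrable and the indicators of measurable subsets are
   admissible in [test]; countably many null sets are then collected. *)
suff : forall n, {ae nu, forall x, Fn n x ->
    (v x)%:E = (- \int[m x]_y (g (x, y) * KA A x y)%:E)%E}.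
  move=> /ae_foralln; apply: filterS => x vx.
  have [n _ Fnx] : (\bigcup_n Fn n) x by rewrite -FnT.
  exact: vx n Fnx.
move=> n; have [mFn Fnoo] := mF n.
apply: integral_ae_eq => //.
- have [F2 _] := L2fun_indic nu _ mFn Fnoo.
  apply/integrable_mkcond => //.
  apply: eq_integrable (L2fun_mul_integrable nu _ _ F2 v2) => // x _.
  by rewrite patchE indicE; case: (x \in Fn n); rewrite ?mul1r ?mul0r.
- apply: measurable_funTS; apply: measurableT_comp => //.
  exact: measurable_div_flux.
- move=> B BF mB; have Boo : (nu B < +oo)%E.
    by apply: le_lt_trans Fnoo; apply: le_measure => //; exact: mem_set.
  have [B2 Bi] := L2fun_indic nu B mB Boo.
  by rewrite -[LHS]integral_indicM -[RHS]integral_indicM; exact: test.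
Qed.

(** By [pairing_flux], the hypothesis compares the integrals of [|grad u| * K] and of
    [(grad u) * g * K]. The first integrand dominates the second at every pair, so the reverse
    inequality of integrals forces equality almost everywhere. *)
Lemma flux_sign u v g : L2fun nu u -> L2fun nu v ->
  measurable_fun setT g -> (forall p, `|g p| <= 1) ->
  (forall x y, g (x, y) = - g (y, x)) ->
  {ae nu, forall x, (v x)%:E = (- \int[m x]_y (g (x, y) * KA A x y)%:E)%E} ->
  (F u <= \int[nu]_x (v x * u x)%:E)%E ->
  {ae mu, forall p, (u p.2 - u p.1) * (g p * K p) = `|u p.2 - u p.1| * K p}.
Proof.
move=> u2 v2 mg g1 gA vE Fu; have [mu' _] := u2.
have Foo : (F u < +oo)%E.
  apply: le_lt_trans Fu _.
  rewrite ltey_eq; apply/orP; left.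
  exact/integrable_fin_num/L2fun_mul_integrable.
have Ei := integrable_energy nu m A mA u mu' Foo.
have mugK : measurable_fun setT (fun p : T * T => (u p.2 - u p.1) * (g p * K p)).
  apply: measurable_funM; first exact: measurable_grad.
  by apply: measurable_funM => //; exact: measurable_KA.
have ugK_le p : `|(u p.2 - u p.1) * (g p * K p)| <= `|u p.2 - u p.1| * K p.
  rewrite normrM ler_wpM2l// normrM (ger0_norm (KA_ge0 _ _ _)).
  by rewrite ler_piMl// KA_ge0.
have ugKi : mu.-integrable setT (fun p => ((u p.2 - u p.1) * (g p * K p))%:E).
  apply: le_integrable Ei => //; first exact/measurable_EFinP.
  by move=> p _; rewrite lee_fin (le_trans (ugK_le p))// ler_norm.
move: Fu; rewrite (pairing_flux nu m A rev mA g mg g1 gA v v2 vE u u2 Foo) F_A1mE//.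
rewrite lee_pmul2l ?lte_fin ?invr_gt0// => Fu.
have d0 p : 0 <= `|u p.2 - u p.1| * K p - (u p.2 - u p.1) * (g p * K p).
  by rewrite subr_ge0; exact: le_trans (ler_norm _) (ugK_le p).
have : (\int[mu]_p `|(`|u p.2 - u p.1| * K p)%:E -
    ((u p.2 - u p.1) * (g p * K p))%:E| = 0)%E.
  rewrite (eq_integral (fun p => (`|u p.2 - u p.1| * K p)%:E -
      ((u p.2 - u p.1) * (g p * K p))%:E)%E); last first.
    by move=> p _; rewrite gee0_abs// -EFinB lee_fin.
  apply/eqP; rewrite eq_le; apply/andP; split; last first.
    by apply: integral_ge0 => p _; rewrite -EFinB lee_fin.
  by rewrite integralB_EFin// sube_le0.
move=> /(ae_eq_integral_abs _ measurableT); set Q := (measurable_fun _ _).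
have mQ : Q.
  apply: emeasurable_funB; first exact: measurable_energy.
  exact/measurable_EFinP.
move=> /(_ mQ); apply: filterS => p /(_ I) /eqP.
by rewrite -EFinB eqe subr_eq0 => /eqP.
Qed.

End theorem.

Theorem theorem4p2 (d : measure_display) (T : measurableType d) (R : realType)
  (m : R.-pker T ~> T) (nu : {measure set T -> \bar R})
  (A : set (T * T)) (u v : T -> R) :
  countably_generated T ->
  sigma_finite setT nu ->
  rws_invariant nu m ->
  rws_reversible nu m ->
  measurable A ->
  L2fun nu u -> L2fun nu v ->
  subdiff_L2 nu (F_A1m nu m A) u v <->
  exists g : T * T -> R,
    [/\ measurable_fun setT g,
        ae_nu_m nu m (fun p => `|g p| <= 1),
        (forall x y, g (x, y) = - g (y, x)),
        {ae nu, forall x,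
           (v x)%:E = (- \int[m x]_y (g (x, y) * KA A x y)%:E)%E} &
        ae_nu_m nu m (fun p => exists2 s, sign_set (u p.2 - u p.1) s &
                         g p * KA A p.1 p.2 = s * KA A p.1 p.2)].
Proof.
move=> _ sf _ rev mA u2 v2; rewrite (subdiff_L2P nu m A mA)//; split.
  move=> [Fu Fge].
  have [g [mg g1 gA vE]] := exists_flux nu m A rev mA v sf v2 Fge.
  exists g; split => //.
    exists set0; split => //; first exact: (measure0 (nuxm nu m)).
    by move=> p /(_ (g1 p)).
  have : {ae nuxm nu m, forall p, exists2 s, sign_set (u p.2 - u p.1) s &
      g p * KA A p.1 p.2 = s * KA A p.1 p.2}; last by [].
  apply: filterS (flux_sign nu m A rev mA u v g u2 v2 mg g1 gA vE Fu) => p.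
  (* Where [K] vanishes any element of the sign set will do; elsewhere [K] is cancelled and [g p]
     itself is taken. *)
  have [->|K0] := eqVneq (KA A p.1 p.2 : R) 0.
    by exists (Num.sg (u p.2 - u p.1)); [exact: sign_set_sgr|rewrite !mulr0].
  rewrite mulrA => /(mulIf K0) gp; exists (g p) => //.
  exact: sign_set_mem.
move=> [g [mg g1 gA vE gu]].
(* The bound on [g] is made to hold everywhere. *)
pose g' p := if `|g p| <= 1 then g p else 0.
have g'E p : `|g p| <= 1 -> g' p = g p by rewrite /g' => ->.
have mg' : measurable_fun setT g'.
  apply: measurable_fun_ifT => //; apply: measurable_fun_ler => //.
  exact: measurableT_comp.
have g'1 p : `|g' p| <= 1 by rewrite /g'; case: ifPn => // _; rewrite normr0.
(* [|g|] is symmetric, so both orders of the pair are truncated together. *)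
have g'A x y : g' (x, y) = - g' (y, x).
  by rewrite /g' gA normrN; case: ifPn => // _; rewrite oppr0.
have v'E : {ae nu, forall x,
    (v x)%:E = (- \int[m x]_y (g' (x, y) * KA A x y)%:E)%E}.
  apply: filterS2 vE (ae_nu_m_section nu m _ g1) => x -> g1x; congr (- _)%E.
  have mgK (k : T * T -> R) : measurable_fun setT k ->
      measurable_fun setT (fun y => (k (x, y) * KA A x y)%:E).
    move=> mk; apply/measurable_EFinP.
    apply: (measurableT_comp (f := fun p => k p * KA A p.1 p.2)
      (g := pair x)) => //.
    by apply: measurable_funM => //; exact: measurable_KA.
  apply: ae_eq_integral => //; [exact: mgK..|].
  by apply: filterS g1x => y gy _; rewrite g'E.
have g'u : {ae nuxm nu m, forall p,
    (u p.2 - u p.1) * (g' p * KA A p.1 p.2) = `|u p.2 - u p.1| * KA A p.1 p.2}.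
  (* [ae_nu_m] is by conversion the almost-everywhere filter of the measure [nuxm]. *)
  have g1' : {ae nuxm nu m, forall p, `|g p| <= 1} := g1.
  have gu' : {ae nuxm nu m, forall p, exists2 s, sign_set (u p.2 - u p.1) s &
    g p * KA A p.1 p.2 = s * KA A p.1 p.2} := gu.
  apply: filterS2 g1' gu' => p gp1 [s us gs].
  by rewrite g'E// gs mulrA (sign_setE _ _ us).
split; first exact: (F_A1m_le_pairing _ _ _ _ _ _ mg' g'1 g'A _ v2 v'E).
exact: (F_A1m_ge_pairing _ _ _ _ _ _ mg' g'1 g'A _ v2 v'E).
Qed.
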